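(* Let $T$ be a complete one-sorted theory and $T_0$ a reduct of $T$. If $T_0$ is dfs-trivial, then $T$ is dfs-trivial.
   Context: A dfs measure is a global Keisler measure definable over and finitely satisfiable in some small model; a measure is trivial if it is a countable convex combination $\sum_k r_k\delta_{a_k}$ of Dirac measures at realized points. A complete one-sorted theory is dfs-trivial if, for every $n\ge1$, every dfs Keisler measure in $n$ variables over its monster model is trivial. Reduct: $T_0$ is a complete theory in a one-sorted relational language $\mathcal{L}_0$ of small cardinality, and there is a finite set $F\subset\mathcal{U}$ (where $\mathcal{U}$ is the monster model of $T$) and, for each $n$-ary $R\in\mathcal{L}_0$, an $\mathcal{L}(\mathcal{U})$-formula $\theta_R(x_1,\dots,x_n)$ in single variables, such that the $\mathcal{L}_0$-structure $(\mathcal{U}\setminus F;(\theta_R)_{R\in\mathcal{L}_0})$ is a model of $T_0$. *)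

(* Defs.v *)
From HB Require Import structures.
From mathcomp Require Import all_boot all_order all_algebra.
From mathcomp Require Import all_classical all_reals all_analysis.

Set Implicit Arguments.
Unset Strict Implicit.
Unset Printing Implicit Defensive.

Import Order.TTheory GRing.Theory Num.Theory.
Import numFieldNormedType.Exports.

Local Open Scope classical_set_scope.
Local Open Scope ring_scope.

(** * One-sorted first-order logic *)

(* Constant symbols are the function symbols of arity 0. *)
Record language := Language {
  fsym : Type;
  farity : fsym -> nat;
  rsym : Type;
  rarity : rsym -> nat }.

Definition relational (L : language) : Prop := fsym L -> False.

Inductive term (L : language) (V : Type) : Type :=
| Var of V
| App (f : fsym L) of ('I_(farity f) -> term L V).

(* [formula L V] is the type of L-formulas with free variables in [V]; the
   quantifier binds the variable [None].  Parameters are handled as extra free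
   variables: an L(A)-formula in n variables, for A a set of elements of a
   structure, is a [formula L ('I_n + A)] in which [inr c] is read as c. *)
Inductive formula (L : language) (V : Type) : Type :=
| Bot
| Eq of term L V & term L V
| Rel (r : rsym L) of ('I_(rarity r) -> term L V)
| Imp of formula L V & formula L V
| All of formula L (option V).

Arguments Var {L V}.
Arguments App {L V}.
Arguments Bot {L V}.
Arguments Rel {L V}.

Definition Neg L V (p : formula L V) : formula L V := Imp p Bot.
Definition Top L V : formula L V := Neg Bot.
Definition Or L V (p q : formula L V) : formula L V := Imp (Neg p) q.
Definition And L V (p q : formula L V) : formula L V := Neg (Imp p (Neg q)).
Arguments Top {L V}.

Fixpoint tsubst L V W (f : V -> W) (t : term L V) : term L W :=
  match t with
  | Var x => Var (f x)
  | App g a => App g (fun i => tsubst f (a i))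
  end.

(* Renaming of free variables. *)
Fixpoint rename L V W (f : V -> W) (p : formula L V) : formula L W :=
  match p with
  | Bot => Bot
  | Eq t u => Eq (tsubst f t) (tsubst f u)
  | Rel r a => Rel r (fun i => tsubst f (a i))
  | Imp p q => Imp (rename f p) (rename f q)
  | All p => All (rename (omap f) p)
  end.

Record structure (L : language) (U : Type) := Structure {
  fint : forall f : fsym L, ('I_(farity f) -> U) -> U;
  rint : forall r : rsym L, ('I_(rarity r) -> U) -> Prop }.

Fixpoint teval L U (S : structure L U) V (v : V -> U) (t : term L V) : U :=
  match t with
  | Var x => v x
  | App f a => fint S (fun i => teval S v (a i))
  end.

Fixpoint sat L U (S : structure L U) V (v : V -> U) (p : formula L V) : Prop :=
  match p with
  | Bot => False
  | Eq t u => teval S v t = teval S v u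
  | Rel r a => rint S (fun i => teval S v (a i))
  | Imp p q => sat S v p -> sat S v q
  | All p => forall x : U, sat S (fun o => if o is Some y then v y else x) p
  end.

Definition sentence (L : language) := formula L void.
Definition theory (L : language) := set (sentence L).

(* A model is nonempty; this is not built into [structure]. *)
Definition models L U (S : structure L U) (T : theory L) : Prop :=
  inhabited U /\ forall p : sentence L, T p -> sat S (of_void U) p.

Definition entails L (T : theory L) (p : sentence L) : Prop :=
  forall U (S : structure L U), models S T -> sat S (of_void U) p.

Definition complete_theory L (T : theory L) : Prop :=
  (exists U (S : structure L U), models S T) /\
  (forall p : sentence L, entails T p \/ entails T (Neg p)).

Definition sumv (V W U : Type) (a : V -> U) (j : W -> U) (z : V + W) : U :=
  match z with inl x => a x | inr c => j c end.

(* Satisfaction of an L(A)-formula by an n-tuple. *)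
Definition psat L U (S : structure L U) (A : set U) n
    (a : 'I_n -> U) (p : formula L ('I_n + A)) : Prop :=
  sat S (sumv a (@set_val U A)) p.

(* Satisfaction of an L(U)-formula by an n-tuple. *)
Definition usat L U (S : structure L U) n
    (a : 'I_n -> U) (p : formula L ('I_n + U)) : Prop :=
  sat S (sumv a id) p.

(* The L(U)-formula p(x, b) obtained from p(x, y). *)
Definition inst L U n m (p : formula L ('I_n + 'I_m)) (b : 'I_m -> U) :
    formula L ('I_n + U) :=
  rename (sumv inl (inr \o b)) p.

Definition elementary_substructure L U (S : structure L U) (M : set U) : Prop :=
  exists SM : structure L M,
    forall n (p : formula L 'I_n) (a : 'I_n -> M),
      sat SM a p <-> sat S (@set_val U M \o a) p.

(** * Type spaces *)

Definition complete_type L U (S : structure L U) (A : set U) n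
    (p : set (formula L ('I_n + A))) : Prop :=
  (forall s : set (formula L ('I_n + A)), finite_set s -> s `<=` p ->
     exists a : 'I_n -> U, forall q, s q -> psat S a q) /\
  (forall q, p q \/ p (Neg q)).

Record type_space L U (S : structure L U) (A : set U) (n : nat) := TypeSpace {
  type_set :> set (formula L ('I_n + A));
  type_setP : complete_type S type_set }.

HB.instance Definition _ L U (S : structure L U) A n :=
  gen_eqMixin (type_space S A n).
HB.instance Definition _ L U (S : structure L U) A n :=
  gen_choiceMixin (type_space S A n).

Definition basic_open L U (S : structure L U) (A : set U) n
    (q : formula L ('I_n + A)) : set (type_space S A n) :=
  [set p | type_set p q].

(* The Stone topology; a subbase suffices since the basic open sets are closed
   under finite intersections. *)
HB.instance Definition _ L U (S : structure L U) A n :=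
  isSubBaseTopological.Build (type_space S A n) (range (@basic_open L U S A n)) id.

Lemma tp_complete L U (S : structure L U) (A : set U) n (a : 'I_n -> U) :
  complete_type S [set q : formula L ('I_n + A) | psat S a q].
Proof.
split; first by move=> s _ sp; exists a.
by move=> q; case: (pselect (psat S a q)) => h; [left|right].
Qed.

Definition tp L U (S : structure L U) (A : set U) n (a : 'I_n -> U) :
    type_space S A n :=
  TypeSpace (@tp_complete L U S A n a).

(** * Monster models *)

Definition card_lt (X Y : Type) (A : set X) (B : set Y) : Prop :=
  (A #<= B)%card /\ ~ (B #<= A)%card.

(* Infinite cardinals kappa are represented by a type K of that cardinality;
   a set A is small when |A| < kappa. *)
Definition small (K X : Type) (A : set X) : Prop := card_lt A [set: K].

Definition saturated (K : Type) L U (S : structure L U) : Prop :=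
  forall A : set U, small K A ->
  forall n (p : type_space S A n), exists a : 'I_n -> U, tp S A a = p.

(* kappa-saturated models with kappa > |L| + aleph_0.  Strong homogeneity is not
   required: no notion below refers to automorphisms, and whether every dfs
   measure is trivial does not depend on the kappa-saturated model chosen. *)
Definition monster (K : Type) L (T : theory L) U (S : structure L U) : Prop :=
  [/\ models S T, small K [set: nat], small K [set: fsym L],
      small K [set: rsym L] & saturated K S].

(** * Keisler measures *)

Record keisler_measure (R : realType) L U (S : structure L U) (n : nat) :=
  KeislerMeasure {
    kmeasure :> formula L ('I_n + U) -> R;
    kmeasure_equiv : forall p q,
      (forall a, usat S a p <-> usat S a q) -> kmeasure p = kmeasure q;
    kmeasure_ge0 : forall p, 0 <= kmeasure p;
    kmeasureT : kmeasure Top = 1;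
    kmeasureU : forall p q, (forall a, ~ (usat S a p /\ usat S a q)) ->
      kmeasure (Or p q) = kmeasure p + kmeasure q }.

Definition finitely_satisfiable_in (R : realType) L U (S : structure L U) n
    (mu : keisler_measure R S n) (M : set U) : Prop :=
  forall p, 0 < mu p -> exists a : 'I_n -> M, usat S (@set_val U M \o a) p.

(* For every p(x, y), the value mu(p(x, b)) depends only on tp(b/M), and the
   induced map on the space of types over M is continuous. *)
Definition definable_over (R : realType) L U (S : structure L U) n
    (mu : keisler_measure R S n) (M : set U) : Prop :=
  forall m (p : formula L ('I_n + 'I_m)),
    exists F : type_space S M m -> R,
      continuous F /\ forall b : 'I_m -> U, F (tp S M b) = mu (inst p b).

Definition dfs (K : Type) (R : realType) L U (S : structure L U) n
    (mu : keisler_measure R S n) : Prop :=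
  exists M : set U,
    [/\ small K M, elementary_substructure S M, definable_over mu M
      & finitely_satisfiable_in mu M].

Definition dirac_at (R : realType) L U (S : structure L U) n
    (a : 'I_n -> U) (p : formula L ('I_n + U)) : R :=
  `[< usat S a p >]%:R.

(* Finite combinations are included, by taking r k = 0 for large k. *)
Definition trivial_measure (R : realType) L U (S : structure L U) n
    (mu : keisler_measure R S n) : Prop :=
  exists (r : nat -> R) (a : nat -> 'I_n -> U),
    [/\ forall k, 0 <= r k,
        \sum_(0 <= k < N) r k @[N --> \oo] --> (1 : R)
      & forall p, \sum_(0 <= k < N) r k * dirac_at R S (a k) p @[N --> \oo]
                    --> mu p].

Definition dfs_trivial (K : Type) (R : realType) L (T : theory L) : Prop :=
  forall U (S : structure L U), monster K T S ->
  forall n, (1 <= n)%N ->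
  forall mu : keisler_measure R S n, dfs K mu -> trivial_measure mu.

(** * Reducts *)

(* The L0-structure (U \ F; (theta_r)_r). *)
Definition induced_structure L0 (rel0 : relational L0) L U (S : structure L U)
    (F : set U) (theta : forall r : rsym L0, formula L ('I_(rarity r) + U)) :
    structure L0 (~` F) :=
  {| fint := fun f _ => False_rect _ (rel0 f);
     rint := fun r (v : 'I_(rarity r) -> ~` F) =>
       usat S (@set_val U (~` F) \o v) (theta r) |}.

Definition is_reduct (K : Type) L (T : theory L) L0 (T0 : theory L0) : Prop :=
  exists rel0 : relational L0,
    [/\ small K [set: rsym L0], complete_theory T0
      & exists U (S : structure L U), monster K T S /\
        exists2 F : set U, finite_set F &
        exists theta : forall r : rsym L0, formula L ('I_(rarity r) + U),
          models (@induced_structure L0 rel0 L U S F theta) T0].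

(* Main.v *)
(* Passing to countably many atoms reduces the theorem to tightness of each
   one-variable marginal: for every e > 0 some finite set of elements has
   measure at least 1 - e. Restrict the i-th marginal of mu to U \ F and to
   L0-formulas, and normalize. A dfs measure remains dfs under this passage, so
   T0 makes it a convex combination of Dirac measures; as equality is an
   L0-formula, the atoms carry the whole mass of mu on x_i \notin F as well.
   Finite satisfiability in the reduct is immediate. Definability in the reduct
   uses it: if b and c have the same L0-type over M0, a positive value of mu on
   phi(x, b) /\ ~ phi(x, c) would be witnessed by some a in M0, which is absurd;
   so the value of mu at phi(x, b) factors through the space of L0-types, which
   is a quotient of the space of L-types by a continuous map of compact spaces.
   It remains to move the parameters of the reduct into the given monster model
   and to find small elementary substructures of the reduct. *)
Require Import Defs.
From mathcomp Require Import finmap.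
From mathcomp Require Import all_boot all_order all_algebra.
From mathcomp Require Import all_classical all_reals all_analysis.
From mathcomp Require Import lra.

Set Implicit Arguments.
Unset Strict Implicit.
Unset Printing Implicit Defensive.

Import Order.TTheory GRing.Theory Num.Theory.
Import numFieldNormedType.Exports.

Local Open Scope classical_set_scope.
Local Open Scope ring_scope.

(** * Cardinals *)

Definition embeds (X Y : Type) : Prop := exists f : X -> Y, injective f.

Lemma embeds_trans X Y Z : embeds X Y -> embeds Y Z -> embeds X Z.
Proof. by move=> [f fi] [g gi]; exists (g \o f); apply: inj_comp. Qed.

Lemma embeds_sub T (A B : set T) : A `<=` B -> embeds A B.
Proof.
move=> AB; have h (x : A) : val x \in B by apply/mem_set/AB/set_mem/valP.
exists (fun x => exist _ (val x) (h x)).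
by move=> x y /(congr1 val) /= /val_inj.
Qed.

Lemma embeds_surj X Y (f : X -> Y) : (forall y, exists x, f x = y) -> embeds Y X.
Proof.
move=> fs; have [g gP] := choice fs; exists g => x y /(congr1 f).
by rewrite !gP.
Qed.

(** By Zorn's lemma there is a maximal graph of a partial injection. It is total on one side, since
    otherwise a missed [x] could be paired with a missed [y]. *)
Lemma embeds_total X Y : embeds X Y \/ embeds Y X.
Proof.
pose P (G : set (X * Y)) := forall u v, G u -> G v -> u.1 = v.1 <-> u.2 = v.2.
have [F FP Ftot|G [PG Gmax]] := @Zorn_bigcup _ P.
  move=> u v [A FA Au] [B FB Bv].
  by case: (Ftot _ _ FA FB) => AB; [apply: (FP B FB) => //; exact: AB|
    apply: (FP A FA) => //; exact: AB].
case: (pselect (forall x, exists y, G (x, y))) => [tot|/existsNP[x Gx]].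
  left; have [f fP] := choice tot; exists f => x1 x2 e.
  by have [_] := PG _ _ (fP x1) (fP x2); apply.
case: (pselect (forall y, exists x, G (x, y))) => [tot|/existsNP[y Gy]].
  right; have [f fP] := choice tot; exists f => y1 y2 e.
  by have [+ _] := PG _ _ (fP y1) (fP y2); apply.
have xN u : G u -> u.1 <> x by case: u => a b /= h ax; apply: Gx; exists b; rewrite -ax.
have yN u : G u -> u.2 <> y by case: u => a b /= h ay; apply: Gy; exists a; rewrite -ay.
exfalso; apply: (Gmax (G `|` [set (x, y)])).
  split=> [|h]; first exact: subsetUl.
  by apply: Gx; exists y; apply: h; right.
move=> u v [Gu|->] [Gv|->] /=; first exact: PG.
- by split=> [/(xN _ Gu)|/(yN _ Gu)].
- by split=> /esym => [/(xN _ Gv)|/(yN _ Gv)].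
- by [].
Qed.

(* Hessenberg's theorem: a maximal injection D * D -> D, with D countably
   infinite or larger, has D as large as its complement, since a copy of D in
   the complement would provide values for the pairs in (D + D)^2 \ D^2. *)
Lemma embeds_square X : embeds nat X -> embeds (X * X) X.
Proof.
move=> [io ioi].
pose D (G : set ((X * X) * X)) := [set x | exists z, G ((x, x), z)].
pose Q G := [/\ forall u v, G u -> G v -> u.1 = v.1 <-> u.2 = v.2,
  forall x y z, G ((x, y), z) -> [/\ D G x, D G y & D G z]
  & forall x y, D G x -> D G y -> exists z, G ((x, y), z)].
pose G0 := [set u : (X * X) * X |
  exists a b, u = ((io a, io b), io (pickle (a, b)))].
have DG0 a : D G0 (io a) by exists (io (pickle (a, a))), a, a.
have QG0 : Q G0.
  split=> [u v [a [b ->]] [c [d ->]] /=|x y z [a [b [-> -> ->]]]|x y].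
  - split=> [[/ioi -> /ioi ->] //|/ioi].
    by move=> /(pcan_inj (@pickleK (nat * nat)%type)) [-> ->].
  - by split; apply: DG0.
  - move=> [_ [a [_ [-> _ _]]]] [_ [b [_ [-> _ _]]]].
    by exists (io (pickle (a, b))), a, b.
(* The condition is put on the union with [G0], so that the empty chain satisfies it and every
   domain contains a copy of [nat]. *)
have [F FP Ftot|G [PG Gmax]] := @Zorn_bigcup _ (fun G => Q (G0 `|` G)).
  have [->|/set0P[G1 FG1]] := eqVneq F set0; first by rewrite bigcup_set0 setU0.
  set H := G0 `|` _.
  have subH G : F G -> G0 `|` G `<=` H.
    by move=> FG; apply: setUS; apply: bigcup_sup.
  have pairH u v : H u -> H v -> exists G, [/\ F G, (G0 `|` G) u & (G0 `|` G) v].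
    move=> [h1|[A FA Au]] [h2|[B FB Bv]].
    - by exists G1; split=> //; left.
    - by exists B; split=> //; [left|right].
    - by exists A; split=> //; [right|left].
    - by case: (Ftot _ _ FA FB) => AB; [exists B|exists A]; split=> //;
        right; rewrite //; exact: AB.
  have DH G : F G -> D (G0 `|` G) `<=` D H.
    by move=> FG x [z h]; exists z; apply: subH h.
  split=> [u v Hu Hv|x y z h|x y [z1 h1] [z2 h2]].
  - by have [A [FA Au Av]] := pairH _ _ Hu Hv; have [+ _ _] := FP A FA; apply.
  - have [A [FA Au _]] := pairH _ _ h h; have [_ + _] := FP A FA.
    by move=> /(_ _ _ _ Au)[? ? ?]; split; apply: (DH A).
  - have [A [FA A1 A2]] := pairH _ _ h1 h2; have [_ _ +] := FP A FA.
    move=> /(_ x y) [||z h]; [by exists z1|by exists z2|].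
    by exists z; apply: (subH A).
set H := G0 `|` G in PG; have [Hi Hd Ht] := PG; set DH := D H in Ht Hd.
have /choice[f fP] : forall x : DH * DH, exists z : DH,
    H ((val x.1, val x.2), val z).
  move=> [x y]; have [z zP] := Ht _ _ (set_mem (valP x)) (set_mem (valP y)).
  have [_ _ /mem_set Dz] := Hd _ _ _ zP.
  by exists (exist _ z Dz).
have fi : injective f.
  move=> [x y] [x' y'] e; have [_] := Hi _ _ (fP (x, y)) (fP (x', y')).
  by rewrite /= e => /(_ erefl)[/val_inj-> /val_inj->].
have io_in a : io a \in DH.
  by apply/mem_set; exists (io (pickle (a, a))); left; exists a, a.
pose iD a : DH := exist _ (io a) (io_in a).
have iDi : injective iD by move=> a b [/ioi].
have [[g gi]|[g gi]] := embeds_total (~` DH) DH.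
  (* If the complement embeds into [DH], the tags [iD 0] and [iD 1] embed all of [X] into [DH * DH],
     and composing with [f] maps pairs from [X] injectively to [X]. *)
  pose h x : DH * DH := match pselect (DH x) with
    | left p => (iD 0, exist _ x (mem_set p))
    | right p => (iD 1, g (exist _ x (mem_set (p : (~` DH) x)))) end.
  have hi : injective h.
    move=> x y; rewrite /h; case: pselect => p; case: pselect => q [].
    - by [].
    - by move/ioi.
    - by move/ioi.
    - by move=> /gi [].
  exists (fun u => val (f (f (h u.1), f (h u.2)))) => -[x y] [x' y'] /=.
  by move=> /val_inj /fi [/fi/hi -> /fi/hi ->].
have gN d : ~ DH (val (g d)) by exact: (set_mem (valP (g d))).
pose ta (bd : bool * DH) := if bd.1 then val (g bd.2) else val bd.2.
have tai : injective ta.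
  move=> [[] d] [[] d']; rewrite /ta /=.
  - by move=> /val_inj/gi ->.
  - by move=> e; case: (gN d); rewrite (e : val (g d) = val d'); exact: set_mem (valP d').
  - by move=> e; case: (gN d'); rewrite -(e : val d = val (g d')); exact: set_mem (valP d).
  - by move=> /val_inj ->.
(* Pairs with at least one entry in the copy of [DH] under [g] take values in that copy, hence away
   from the old values. *)
pose c (u v : bool * DH) := g (f (iD (pickle (u.1, v.1)), f (u.2, v.2))).
have ci u v u' v' : c u v = c u' v' -> u = u' /\ v = v'.
  case: u v u' v' => [b d] [b1 d1] [b' d'] [b1' d1'] /gi/fi[] /ioi.
  by move=> /(pcan_inj (@pickleK (bool * bool)%type)) [-> ->] /fi [-> ->].
pose N := [set w : (X * X) * X |
  exists u v, u.1 || v.1 /\ w = ((ta u, ta v), val (c u v))].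
have D2 x : D (H `|` N) x <-> exists u, x = ta u.
  split=> [[z [h|[u [v [_ [-> _ _]]]]]]|[[[] d] ->]].
  - by exists (false, exist _ x (mem_set (ex_intro _ z h : DH x))).
  - by exists u.
  - by exists (val (c (true, d) (true, d))); right; exists (true, d), (true, d).
  - by have [z h] := set_mem (valP d); exists z; left.
have DHta x : DH x -> exists u, x = ta u.
  by move=> h; exists (false, exist _ x (mem_set h)).
have HNN u v : H u -> N v -> u.1 <> v.1 /\ u.2 <> v.2.
  case: u => [[x y] z] h [[b d] [[b' d'] [/= bb ->]]] /=.
  have [hx hy hz] := Hd _ _ _ h; split.
    case: b b' bb => [] [] //= _; rewrite /ta /= => -[ex ey].
    - by apply: (gN d); rewrite -(ex : x = val (g d)).
    - by apply: (gN d); rewrite -(ex : x = val (g d)).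
    - by apply: (gN d'); rewrite -(ey : y = val (g d')).
  by move=> e; move: hz; rewrite (e : z = val (g _)); apply: gN.
exfalso; apply: (Gmax (G `|` N)).
  split=> [|h]; first exact: subsetUl.
  have n : N ((ta (true, iD 0), ta (true, iD 0)), val (c (true, iD 0) (true, iD 0))).
    by exists (true, iD 0), (true, iD 0).
  have m := h _ (or_intror n).
  by have [] := HNN _ _ (or_intror m) n.
rewrite setUA -/H; split=> [u v [hu|nu] [hv|nv]|x y z|x y].
- exact: Hi.
- by have [n1 n2] := HNN _ _ hu nv; split.
- by have [n1 n2] := HNN _ _ hv nu; split=> /esym.
- move: nu nv => [u1 [u2 [_ ->]]] [v1 [v2 [_ ->]]] /=.
  by split=> [[/tai -> /tai ->]|/val_inj /ci [-> ->]].
- case=> [h|[u [v [b [-> -> ->]]]]].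
    by have [h1 h2 h3] := Hd _ _ _ h; split; apply/D2; apply: DHta.
  split; apply/D2; [by exists u|by exists v|].
  by exists (true, f (iD (pickle (u.1, v.1)), f (u.2, v.2))).
- move=> /D2 [u ->] /D2 [v ->].
  have [b|/negP b] := pselect (is_true (u.1 || v.1)).
    by exists (val (c u v)); right; exists u, v.
  case: u v b => [[] d] [[] d'] //= _.
  by have [z h] := Ht _ _ (set_mem (valP d)) (set_mem (valP d')); exists z; left.
Qed.

Definition lesser (K X : Type) : Prop := embeds X K /\ ~ embeds K X.

Lemma card_le_embeds X Y (A : set X) (B : set Y) : (A #<= B)%card <-> embeds A B.
Proof.
split=> [/card_leP[f]|[f fi]].
  by exists f => x y; apply: inj; rewrite inE.
by apply/card_leP/injfunPex; exists f => // x y _ _; apply: fi.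
Qed.

Lemma embedsT X : embeds X [set: X] /\ embeds [set: X] X.
Proof.
split; last by exists val; exact: val_inj.
by exists (fun x => exist _ x (in_setT x)) => x y [].
Qed.

Lemma smallE K X (A : set X) : small K A <-> lesser K A.
Proof.
rewrite /small /card_lt !card_le_embeds; have [h1 h2] := embedsT K.
split=> -[a b]; (split; [exact: embeds_trans a _|move=> h; apply: b]).
- exact: embeds_trans h2 h.
- exact: embeds_trans h1 h.
Qed.

Lemma lesser_embeds K X Y : embeds X Y -> lesser K Y -> lesser K X.
Proof.
move=> XY [YK KY]; split; first exact: embeds_trans XY YK.
by move=> KX; apply: KY; apply: embeds_trans KX XY.
Qed.

Lemma lesser_setT K X : small K [set: X] <-> lesser K X.
Proof.
rewrite smallE; have [h1 h2] := embedsT X.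
by split; apply: lesser_embeds.
Qed.

(* If an injection K * K -> X + Y took, in each row, a value in X, then K would
   embed into X; otherwise some row embeds K into Y. *)
Lemma lesser_sum K X Y :
  lesser K nat -> lesser K X -> lesser K Y -> lesser K (X + Y).
Proof.
move=> [Kinf _] [[a ai] KX] [[b bi] KY]; have [e ei] := embeds_square Kinf.
have [io ioi] := Kinf; split.
  exists (sumv (fun x => e (io 0%N, a x)) (fun y => e (io 1%N, b y))).
  move=> [x|y] [x'|y'] /ei [].
  - by move=> /ai ->.
  - by move=> /ioi.
  - by move=> /ioi.
  - by move=> /bi ->.
move=> [g gi]; pose h k l := g (e (k, l)).
have hi k l k' l' : h k l = h k' l' -> k = k' /\ l = l' by move=> /gi/ei [].
case: (pselect (exists k, forall l, exists y, h k l = inr y)) => [[k /choice[f fP]]|n].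
  apply: KY; exists f => l l' e'.
  by have [] := hi k l k l' _; first by rewrite !fP e'.
have /choice[f fP] : forall k, exists x, exists l, h k l = inl x.
  move=> k; apply: contrapT => nx; apply: n; exists k => l.
  case hx : (h k l) => [x|y]; last by exists y.
  by case: nx; exists x, l.
apply: KX; exists f => k k' e'.
have [l lP] := fP k; have [l' lP'] := fP k'.
by have [] := hi k l k' l' _; first by rewrite lP lP' e'.
Qed.

(** The product sits inside the square of [X + Y + nat]; the summand [nat] makes this type infinite,
    so that [embeds_square] applies. *)
Lemma lesser_prod K X Y :
  lesser K nat -> lesser K X -> lesser K Y -> lesser K (X * Y).
Proof.
move=> Kn KX KY; apply: (@lesser_embeds _ _ ((X + Y) + nat)%type); last first.
  by do 2?apply: lesser_sum.
apply: (@embeds_trans _ (((X + Y) + nat) * ((X + Y) + nat))%type).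
  by exists (fun u => (inl (inl u.1), inl (inr u.2))) => -[a b] [c d] [-> ->].
by apply: embeds_square; exists inr => a b [].
Qed.

Lemma small_setU K T (A B : set T) :
  lesser K nat -> small K A -> small K B -> small K (A `|` B).
Proof.
rewrite !smallE => Kn KA KB; apply: lesser_embeds (lesser_sum Kn KA KB).
apply: (@embeds_surj _ _ (fun z : A + B => match z with
  | inl x => exist _ (val x) (mem_set (or_introl (set_mem (valP x))))
  | inr x => exist _ (val x) (mem_set (or_intror (set_mem (valP x)))) end)).
move=> [x xP]; have [h|h] := set_mem xP.
  by exists (inl (exist _ x (mem_set h))); apply: val_inj.
by exists (inr (exist _ x (mem_set h))); apply: val_inj.
Qed.

Lemma small_image K X Y (f : X -> Y) (A : set X) : small K A -> small K (f @` A).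
Proof.
rewrite !smallE; apply: lesser_embeds; apply/card_le_embeds; exact: card_image_le.
Qed.

Lemma small_sub K X (A B : set X) : A `<=` B -> small K B -> small K A.
Proof. by move=> AB; rewrite !smallE; apply: lesser_embeds; apply: embeds_sub. Qed.

Lemma finite_range (X : Type) (A : set X) : finite_set A ->
  exists k (f : 'I_k -> X), A = range f.
Proof.
move=> /(@finite_seqP {classic X})[s ->]; exists (size s), (tnth (in_tuple s)).
apply/seteqP; split=> x /=; last by move=> [i _ <-]; exact: mem_tnth.
by move=> /(tnthP (in_tuple s)) [i ->]; exists i.
Qed.

(** * Renaming, types and saturation *)

Lemma teval_tsubst L U (S : structure L U) V W (f : V -> W) (v : W -> U) t :
  teval S v (tsubst f t) = teval S (v \o f) t.
Proof.
elim: t => [x|g a IH] //=; congr fint.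
by apply: funext => i; exact: IH.
Qed.

Lemma sat_rename L U (S : structure L U) V W (f : V -> W) (v : W -> U) p :
  sat S v (rename f p) <-> sat S (v \o f) p.
Proof.
elim: p W f v => [V'|V' t u|V' r a|V' p IHp q IHq|V' p IH] W f v //=.
- by rewrite !teval_tsubst.
- suff -> : (fun i => teval S v (tsubst f (a i))) =
     (fun i => teval S (v \o f) (a i)) by [].
  by apply: funext => i; rewrite teval_tsubst.
- by have := IHp W f v; have := IHq W f v; tauto.
- have E x : (fun o => if o is Some y then v y else x) \o omap f =
    (fun o => if o is Some y then (v \o f) y else x).
    by apply: funext => -[].
  by split=> h x; [rewrite -E; apply/IH; apply: h|apply/IH; rewrite E; apply: h].
Qed.

Lemma sat_Neg L U (S : structure L U) V (v : V -> U) p :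
  sat S v (Neg p) <-> ~ sat S v p.
Proof. by []. Qed.

Lemma sat_And L U (S : structure L U) V (v : V -> U) p q :
  sat S v (And p q) <-> sat S v p /\ sat S v q.
Proof. by rewrite /=; split; [move=> h; apply: contrapT; tauto|tauto]. Qed.

Lemma sat_Or L U (S : structure L U) V (v : V -> U) p q :
  sat S v (Or p q) <-> sat S v p \/ sat S v q.
Proof. by rewrite /=; split; [move=> h; apply: contrapT; tauto|tauto]. Qed.

Lemma finite_conj L V (s : set (formula L V)) : finite_set s ->
  exists q, forall U (S : structure L U) v,
    sat S v q <-> forall p, s p -> sat S v p.
Proof.
move=> /(@finite_seqP {classic (formula L V)})[l ->].
elim: l => [|p l [q qP]].
  exists Top => U S v; split=> [_ p pN|_ []].
  by case: (notF pN).
exists (And p q) => U S v; rewrite sat_And qP; split=> [[h1 h2] p'|h].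
  by rewrite /= inE => /orP[/eqP -> //|]; apply: h2.
split=> [|p' h']; first by apply: h; rewrite /= inE eqxx.
by apply: h; rewrite /= inE; apply/orP; right.
Qed.

(** * Free variables and changes of the type of variables *)

Fixpoint tfv L (V : Type) (t : term L V) : set V :=
  match t with
  | Var x => [set x]
  | App f a => \bigcup_i tfv (a i)
  end.

Fixpoint fv L (V : Type) (p : formula L V) : set V :=
  match p with
  | Bot => set0
  | Eq t u => tfv t `|` tfv u
  | Rel r a => \bigcup_i tfv (a i)
  | Imp p q => fv p `|` fv q
  | All p => Some @^-1` fv p
  end.

Lemma tfv_finite L V (t : term L V) : finite_set (tfv t).
Proof.
elim: t => [x|f a IH] /=; first exact: finite_set1.
by apply: bigcup_finite => // i _; exact: IH.
Qed.

Lemma fv_finite L V (p : formula L V) : finite_set (fv p).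
Proof.
elim: p => [V'|V' t u|V' r a|V' p IHp q IHq|V' p IH] /=.
- exact: finite_set0.
- by rewrite finite_setU; split; exact: tfv_finite.
- by apply: bigcup_finite => // i _; exact: tfv_finite.
- by rewrite finite_setU.
- by apply: finite_preimage => // x y _ _ [].
Qed.

Lemma tsubst_factor L V W (h : W -> V) (t : term L V) :
  tfv t `<=` range h -> exists t', t = tsubst h t'.
Proof.
elim: t => [x|f a IH] /= sub; first by have [w _ <-] := sub x erefl; exists (Var w).
have /choice[b bP] : forall i, exists t', a i = tsubst h t'.
  by move=> i; apply: IH => x ax; apply: sub; exists i.
by exists (App f b) => /=; congr App; apply: funext.
Qed.

(** Each free variable is replaced by a preimage under [h]. This brings a formula back to finitely
    many parameters, to a small set of them, or to one stage of a chain. *)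
Lemma rename_factor L V W (h : W -> V) (p : formula L V) :
  fv p `<=` range h -> exists p', p = rename h p'.
Proof.
elim: p W h => [V'|V' t u|V' r a|V' p IHp q IHq|V' p IH] W h /= sub.
- by exists Bot.
- have [t' ->] : exists t', t = tsubst h t'.
    by apply: tsubst_factor => x tx; apply: sub; left.
  have [u' ->] : exists u', u = tsubst h u'.
    by apply: tsubst_factor => x tx; apply: sub; right.
  by exists (Eq t' u').
- have /choice[b bP] : forall i, exists t', a i = tsubst h t'.
    by move=> i; apply: tsubst_factor => x ax; apply: sub; exists i.
  by exists (Rel r b) => /=; congr Rel; apply: funext.
- have [p' ->] := IHp W h (fun x px => sub x (or_introl px)).
  have [q' ->] := IHq W h (fun x qx => sub x (or_intror qx)).
  by exists (Imp p' q').
- have [|p' ->] := IH _ (omap h); last by exists (All p').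
  move=> [x|] px; last by exists None.
  by have [w _ <-] := sub x px; exists (Some w).
Qed.

Lemma rename_factor_params L n V (p : formula L ('I_n + V)) :
  exists k (f : 'I_k -> V) (p' : formula L ('I_n + 'I_k)),
    p = rename (sumv inl (inr \o f)) p'.
Proof.
have [k [f fP]] : exists k (f : 'I_k -> V), inr @^-1` fv p = range f.
  by apply: finite_range; apply: finite_preimage (fv_finite p) => x y _ _ [].
exists k, f; apply: rename_factor => -[i|x] px; first by exists (inl i).
have [i _ <-] : range f x by rewrite -fP.
by exists (inr i).
Qed.

(** * Complete types and their realizations *)

Lemma type_And L U (S : structure L U) (A : set U) n (t : type_space S A n) p q :
  type_set t p -> type_set t q -> type_set t (And p q).
Proof.
move=> tp tq; have [fs tot] := type_setP t; have [//|tN] := tot (And p q).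
(* Finite satisfiability refutes the other alternative: no tuple satisfies [p], [q] and the negation
   of their conjunction. *)
have [||a aP] := fs [set p; q; Neg (And p q)].
- exact: finite_set3.
- by move=> _ [[->|->]|->].
have ap : psat S a p by apply: aP; left; left.
have aq : psat S a q by apply: aP; left; right.
have aN : psat S a (Neg (And p q)) by apply: aP; right.
by exfalso; apply: aN; apply/sat_And.
Qed.

Lemma type_sat L U (S : structure L U) (A : set U) n (t : type_space S A n) p :
  type_set t p -> exists a, psat S a p.
Proof.
move=> tp; have [fs _] := type_setP t.
have [||a aP] := fs [set p]; first exact: finite_set1.
  by move=> _ ->.
by exists a; exact: aP.
Qed.

(** Complete types are maximal: a formula of [t2] outside [t1] would have its negation in [t1],
    hence in [t2]. *)
Lemma type_ext L U (S : structure L U) (A : set U) n (t1 t2 : type_space S A n) :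
  (forall p, type_set t1 p -> type_set t2 p) -> t1 = t2.
Proof.
case: t1 t2 => [t1 h1] [t2 h2] /= s12.
suff e : t1 = t2 by subst t2; congr TypeSpace; exact: Prop_irrelevance.
apply/seteqP; split=> // p t2p; have [_ tot] := h1; have [//|tN] := tot p.
have [a] := type_sat (type_And (t := TypeSpace h2) t2p (s12 _ tN)).
by rewrite /psat sat_And => -[ap aN]; case: (aN ap).
Qed.

Lemma filter_finite_forall T I (F : set_system T) (s : set I) (f : I -> set T) :
  Filter F -> finite_set s -> (forall i, s i -> F (f i)) ->
  F [set x | forall i, s i -> f i x].
Proof.
move=> FF /(@finite_fsetP {classic I})[X ->] FX.
apply: filterS (@filter_bigI T {classic I} X f F FF _) => //.
Qed.

(** A proper filter plays the part of a partial type. The formulas that hold on a member of an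
    ultrafilter above it form a complete type, which saturation realizes. *)
Lemma realize_filter K L U (S : structure L U) (A : set U) n
    (F : set_system ('I_n -> U)) :
  saturated K S -> small K A -> ProperFilter F ->
  exists a : 'I_n -> U, forall q : formula L ('I_n + A),
    F [set b | psat S b q] -> psat S a q.
Proof.
move=> sat_S sA PF; have [G [UG FG]] := ultraFilterLemma PF.
have comp : complete_type S [set q : formula L ('I_n + A) | G [set b | psat S b q]].
  split=> [s sfin sG|q]; last exact: in_ultra_setVsetC.
  have [a aP] := filter_ex (filter_finite_forall
    (f := fun (q : formula L ('I_n + A)) => [set b | psat S b q]) _ sfin sG).
  by exists a.
have [a aE] := sat_S A sA n (TypeSpace comp); exists a => q Fq.
suff : type_set (tp S A a) q by [].
by rewrite aE; apply: FG.
Qed.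
(** * Transfer of parameters and small elementary substructures *)

Lemma total_on_finite T (F : set (set T)) (B : set T) :
  total_on F subset -> F !=set0 -> finite_set B -> B `<=` \bigcup_(X in F) X ->
  exists2 G, F G & B `<=` G.
Proof.
move=> Ftot [G0 FG0] /finite_range[k [f ->]] sub.
have {}sub i : (\bigcup_(X in F) X) (f i) by apply: sub; exists i.
suff [G FG fG] : exists2 G, F G & forall i, G (f i).
  by exists G => // _ [i _ <-].
elim: k f sub => [|k IH] f sub; first by exists G0 => // -[].
have [G1 FG1 h1] := IH (f \o lift ord0) (fun i => sub _).
have [G2 FG2 h2] := sub ord0.
have [G12|G21] := Ftot _ _ FG1 FG2.
  exists G2 => // i; have [j ->|->//] := unliftP ord0 i.
  by apply: G12; exact: h1.
exists G1 => // i; have [j ->|->] := unliftP ord0 i; first exact: h1.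
exact: G21.
Qed.

Section Transfer.
Variables (L : language) (U1 U : Type) (S1 : structure L U1) (S : structure L U).

(** The pairs in [G] are themselves the variables, read by first components in [S1] and by second
    components in [S]. Equations between variables then make [G] the graph of an injection. *)
Let partial_elementary (G : set (U1 * U)) : Prop :=
  forall p : formula L G, sat S1 (fst \o val) p <-> sat S (snd \o val) p.

Let partial_elementary_inj G u v :
  partial_elementary G -> G u -> G v -> u.1 = v.1 <-> u.2 = v.2.
Proof.
by move=> GE Gu Gv; have := GE (Eq (Var (exist _ u (mem_set Gu)))
  (Var (exist _ v (mem_set Gv)))).
Qed.

(** The formulas true of [c] over the domain of [G], carried to its image, generate a proper filter
    because [G] preserves existential statements. A realization is an image for [c]. *)
Let partial_elementary_extend K G c :
  saturated K S -> small K (snd @` G) -> partial_elementary G ->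
  exists a, partial_elementary (G `|` [set (c, a)]).
Proof.
move=> Ssat sG GE; set B := snd @` G in sG.
have /choice[g gP] : forall b : B, exists u : G, (val u).2 = val b.
  by move=> [b bB]; have [u Gu ub] := set_mem bB; exists (exist _ u (mem_set Gu)).
pose v1 : 'I_1 + B -> U1 := sumv (fun=> c) (fst \o (val \o g)).
pose F := filter_from [set q | sat S1 v1 q] (fun q => [set a | psat S a q]).
have FF : Filter F.
  apply: filter_from_filter => [|p q p1 q1]; first by exists Top.
  by exists (And p q) => [|a]; [exact/sat_And|rewrite /= /psat sat_And].
have PF : ProperFilter F.
  apply: filter_from_proper => q q1.
  pose h (z : 'I_1 + B) := match z with inl _ => None | inr b => Some b end.
  have qG := GE (rename g (Neg (All (Neg (rename h q))))).
  have /qG : sat S1 (fst \o val) (rename g (Neg (All (Neg (rename h q))))).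
    apply/sat_rename => /(_ c); apply; apply/sat_rename.
    by congr (sat S1 _ q): q1; apply: funext => -[].
  rewrite sat_rename => /existsNP[a /contrapT/sat_rename aq].
  exists (fun=> a); congr (sat S _ q): aq; apply: funext => -[//|b] /=.
  exact: gP.
have [a aP] := realize_filter Ssat sG PF.
have aE q : sat S1 v1 q <-> psat S a q.
  split=> [q1|aq]; first by apply: aP; exists q.
  by apply: contrapT => qN; have /(_ aq) : psat S a (Neg q) by apply: aP; exists (Neg q).
exists (a ord0); set G' := G `|` _ => p.
have Bsnd (z : G') : G (val z) -> (val z).2 \in B.
  by move=> Gz; apply/mem_set; exists (val z).
pose h (z : G') : 'I_1 + B := match pselect (G (val z)) with
  | left Gz => inr (exist _ (val z).2 (Bsnd z Gz)) | right _ => inl ord0 end.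
have -> : @eq (G' -> U1) (fst \o val) (v1 \o h).
  apply: funext => z; rewrite /h /=; case: pselect => Gz /=.
    by apply/(partial_elementary_inj GE Gz (set_mem (valP (g _)))); rewrite gP.
  have [/Gz//|] : (G `|` [set (c, a ord0)]) (val z) := set_mem (valP z).
  by move=> /= ->.
have -> : @eq (G' -> U) (snd \o val) (sumv a val \o h).
  apply: funext => z; rewrite /h /=; case: pselect => Gz //=.
  have [/Gz//|] : (G `|` [set (c, a ord0)]) (val z) := set_mem (valP z).
  by move=> /= ->.
by rewrite -!sat_rename; exact: aE.
Qed.

(* Saturation is stated for finite tuples only, so a small parameter set is
   transferred one element at a time, along a maximal partial elementary map. *)
Lemma elementary_transfer K (T : theory L) (A : set U1) :
  complete_theory T -> models S1 T -> models S T -> saturated K S ->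
  small K A ->
  exists j : A -> U, forall p : formula L A, sat S1 val p <-> sat S j p.
Proof.
move=> [_ Tc] M1 M Ssat sA.
(* Completeness of [T] settles formulas without free variables; in particular the empty map, the
   union of the empty chain, is partial elementary. *)
have TE V (p : formula L V) (v1 : V -> U1) (v : V -> U) :
    fv p = set0 -> sat S1 v1 p <-> sat S v p.
  move=> p0; have [|q ->] := @rename_factor L V void (of_void V) p.
    by rewrite p0; exact: sub0set.
  rewrite !sat_rename.
  have -> : v1 \o of_void V = of_void U1 by apply: funext => -[].
  have -> : v \o of_void V = of_void U by apply: funext => -[].
  by have [h|h] := Tc q; have := h _ _ M1; have := h _ _ M; rewrite /=; tauto.
pose P G := (forall u, G u -> A u.1) /\ partial_elementary G.
have [F FP Ftot|G [[GA GE] Gmax]] := @Zorn_bigcup _ P.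
  split=> [u [G FG Gu]|p]; first exact: (FP G FG).1.
  have [p0|/set0P[x0 px0]] := eqVneq (fv p) set0; first exact: TE.
  have [G FG Gp] : exists2 G, F G & forall z, fv p z -> G (val z).
    have [||G FG Gp] := total_on_finite Ftot _ (finite_image val (fv_finite p)).
    - by have [X FX _] := set_mem (valP x0); exists X.
    - by move=> _ [z _ <-]; exact: set_mem (valP z).
    - by exists G => // z pz; apply: Gp; exists z.
  have sub : G `<=` \bigcup_(X in F) X by apply: bigcup_sup.
  pose h (z : G) : \bigcup_(X in F) X :=
    exist _ (val z) (mem_set (sub _ (set_mem (valP z)))).
  have [z pz|q ->] := @rename_factor L _ G h p.
    by exists (exist _ (val z) (mem_set (Gp _ pz))) => //; apply: val_inj.
  rewrite !sat_rename; exact: (FP G FG).2.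
have sG : small K G.
  move: sA; rewrite !smallE; apply: lesser_embeds.
  exists (fun z : G => exist _ (val z).1 (mem_set (GA _ (set_mem (valP z))))).
  move=> x y [e]; apply: val_inj.
  have e2 := (partial_elementary_inj GE (set_mem (valP x)) (set_mem (valP y))).1 e.
  by move: x y e e2 => [[a b] i] [[a' b'] i'] /= -> ->.
have Gtot (x : A) : exists y, G (val x, y).
  have [y GyE] := partial_elementary_extend (val x) Ssat (small_image snd sG) GE.
  exists y; apply: contrapT => Gxy; apply: (Gmax (G `|` [set (val x, y)])).
    split=> [|h]; first exact: subsetUl.
    by apply: Gxy; apply: h; right.
  by split=> // u [/GA //|->]; exact: set_mem (valP x).
have [j jP] := choice Gtot; exists j => p.
pose h x : G := exist _ (val x, j x) (mem_set (jP x)).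
by have := GE (rename h p); rewrite !sat_rename.
Qed.

End Transfer.

(** * Codes of formulas and Skolem terms, and the downward Lowenheim-Skolem theorem *)

Section Coding.
Variables (L : language) (rel0 : relational L) (Y : Type).
Variables (e : Y * Y -> Y) (io : nat -> Y) (cr : rsym L -> Y).
Hypotheses (ei : injective e) (ioi : injective io) (cri : injective cr).

Fixpoint code_seq (s : seq Y) : Y :=
  if s is y :: s' then e (io 1%N, e (y, code_seq s')) else e (io 0%N, io 0%N).

Lemma code_seq_inj : injective code_seq.
Proof.
elim=> [|y s IH] [|y' s'] //= /ei [].
- by move=> /ioi.
- by move=> /ioi.
- by move=> /ei [-> /IH ->].
Qed.

Definition code_fun n (f : 'I_n -> Y) : Y := code_seq [seq f i | i <- enum 'I_n].

Lemma code_fun_inj n : injective (@code_fun n).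
Proof.
move=> f g /code_seq_inj /eq_in_map fg; apply: funext => i.
by apply: fg; rewrite mem_enum.
Qed.

Definition code_term V (c : V -> Y) (t : term L V) : Y :=
  match t with Var x => c x | App f _ => False_rect _ (rel0 f) end.

Lemma code_term_inj V (c : V -> Y) : injective c -> injective (code_term c).
Proof.
move=> ci [x|f a]; last by case: (rel0 f).
by case=> [y /ci ->|g b] //; case: (rel0 g).
Qed.

Definition code_option V (c : V -> Y) (o : option V) : Y :=
  if o is Some x then e (io 1%N, c x) else e (io 0%N, io 0%N).

Lemma code_option_inj V (c : V -> Y) : injective c -> injective (code_option c).
Proof.
move=> ci [x|] [y|] //= /ei [].
- by move=> /ci ->.
- by move=> /ioi.
- by move=> /ioi.
Qed.

(** Injectivity of the code bounds the number of formulas by the size of [Y]. The values of [io] tag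
    the constructors; the second [io 0%N] under [Bot] is padding. *)
Fixpoint code_formula (V : Type) (c : V -> Y) (p : formula L V) : Y :=
  match p with
  | Bot => e (io 0%N, io 0%N)
  | Eq t u => e (io 1%N, e (code_term c t, code_term c u))
  | Rel r a => e (io 2%N, e (cr r, code_fun (code_term c \o a)))
  | Imp p q => e (io 3%N, e (code_formula c p, code_formula c q))
  | All p => e (io 4%N, code_formula (code_option c) p)
  end.

Lemma code_formula_inj V (c : V -> Y) : injective c -> injective (code_formula c).
Proof.
move=> ci p; elim: p c ci => [V'|V' t u|V' r a|V' p IHp q IHq|V' p IH] c ci;
  case=> [|t' u'|r' a'|p' q'|p'] //= /ei []; try by move=> /ioi.
- by move=> /ei [/(code_term_inj ci) -> /(code_term_inj ci) ->].
- move=> /ei [/cri rr']; subst r' => /code_fun_inj h; congr Rel.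
  apply: funext => i; apply: (code_term_inj ci).
  by have := congr1 (fun f => f i) h.
- by move=> /ei [/(IHp _ ci) -> /(IHq _ ci) ->].
- by move=> /(IH _ (code_option_inj ci)) ->.
Qed.

(* Closed Skolem terms over X: [SkWit p a] names a witness of p(a, y). *)
Inductive skolem (X : Type) : Type :=
| SkBase of X
| SkWit n (p : formula L (option 'I_n)) of ('I_n -> skolem X).

(** The arity [n] is coded before [p] and [a], whose types depend on it. *)
Fixpoint code_skolem X (cb : X -> Y) (s : skolem X) : Y :=
  match s with
  | SkBase x => e (io 0%N, cb x)
  | @SkWit _ n p a => e (io 1%N, e (io n,
      e (code_formula (code_option (io \o @nat_of_ord n)) p,
         code_fun (fun i => code_skolem cb (a i)))))
  end.

Lemma code_skolem_inj X (cb : X -> Y) : injective cb -> injective (code_skolem cb).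
Proof.
move=> cbi; elim=> [x|n p a IH] [x'|n' p' a'] //= /ei []; try by move=> /ioi.
- by move=> /cbi ->.
- move=> /ei [/ioi nn']; subst n'.
  have ci : injective (code_option (io \o @nat_of_ord n)).
    by apply: code_option_inj; apply: inj_comp; [exact: ioi|exact: val_inj].
  move=> /ei [/(code_formula_inj ci) -> /code_fun_inj h].
  congr SkWit; apply: funext => i; apply: IH.
  by have := congr1 (fun f => f i) h.
Qed.

End Coding.

Arguments SkBase {L X}.

(** [M] is the Skolem hull of [B]. Coding Skolem terms in [Y] makes it small, and the Tarski-Vaught
    criterion makes it elementary. *)
Lemma lowenheim_skolem K L U (S : structure L U) (B : set U) :
  relational L -> inhabited U -> lesser K nat -> small K [set: rsym L] ->
  small K B ->
  exists M, [/\ B `<=` M, small K M & elementary_substructure S M].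
Proof.
move=> rel0 [u0] Kn /lesser_setT Kr KB.
pose Y := ((B + rsym L) + nat)%type.
have KY : lesser K Y by do 2?apply: lesser_sum => //; rewrite -smallE.
have [e ei] : embeds (Y * Y) Y by apply: embeds_square; exists inr => a b [].
(* The default value [u0] is taken when no witness exists. *)
pose wit n (p : formula L (option 'I_n)) (v : 'I_n -> U) : U :=
  match pselect (exists x, sat S (oapp v x) p) with
  | left h => projT1 (cid h) | right _ => u0 end.
have witP n p v x : sat S (oapp v x) p -> sat S (oapp v (@wit n p v)) p.
  by rewrite /wit; case: pselect => [h|h hx]; [case: cid|case: h; exists x].
pose fix ev (s : skolem L B) : U := match s with
  | SkBase x => val x
  | SkWit n p a => wit n p (fun i => ev (a i)) end.
exists (range ev); split.
- by move=> x Bx; exists (SkBase (exist _ x (mem_set Bx))).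
- apply: small_image; apply/lesser_setT; apply: lesser_embeds KY.
  exists (code_skolem rel0 e inr (fun r => inl (inr r)) (fun b => inl (inl b))).
  by apply: code_skolem_inj => //; [move=> ? ? []|move=> ? ? []|move=> ? ? []].
set M := range ev.
exists {| fint := fun f _ => False_rect _ (rel0 f);
          rint := fun r (v : _ -> M) => rint S (val \o v) |} => n p.
(* The induction needs an arbitrary type of variables, since a quantifier leads from [V] to
   [option V]. *)
move: {n} 'I_n p => V p; elim: p => [V'|V' t u|V' r a|V' p IHp q IHq|V' p IH] v //=.
- case: t => [x|f ?]; last by case: (rel0 f).
  case: u => [y|g ?]; last by case: (rel0 g).
  by rewrite /=; split=> [->|/val_inj].
- suff -> : val \o (fun i => teval {| fint := fun f _ => False_rect _ (rel0 f);
     rint := fun r (v : _ -> M) => rint S (val \o v) |} v (a i)) =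
     fun i => teval S (val \o v) (a i) by [].
  by apply: funext => i /=; case: (a i) => [//|f ?]; case: (rel0 f).
- by have := IHp v; have := IHq v; tauto.
have E (x : M) : val \o (fun o => if o is Some y then v y else x) =
    oapp (val \o v) (val x) by apply: funext => -[].
split=> h x; last by apply/IH; rewrite E; exact: h.
(* Given a counterexample [x] to [p], finitely many elements of [M] occur as parameters, so a Skolem
   term names a counterexample inside [M]. *)
apply: contrapT => px.
have [k [f fP]] : exists k (f : 'I_k -> V'), Some @^-1` fv p = range f.
  by apply: finite_range; apply: finite_preimage (fv_finite p) => ? ? _ _ [].
have [|p' pE] := @rename_factor L _ _ (omap f) p.
  move=> [y|] py; last by exists None.
  have [i _ <-] : range f y by rewrite -fP.
  by exists (Some i).
have /choice[sk skP] : forall z : M, exists s, ev s = val z.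
  by move=> z; have [s _ ?] := set_mem (valP z); exists s.
pose s := SkWit (Neg p') (sk \o (v \o f)).
have Ms : ev s \in M by apply/mem_set; exists s.
have evE : (fun i => ev ((sk \o (v \o f)) i)) = val \o (v \o f).
  by apply: funext => i; exact: skP.
have oE y : oapp (val \o v) y \o omap f = oapp (val \o (v \o f)) y.
  by apply: funext => -[].
have : sat S (oapp (val \o (v \o f)) (ev s)) (Neg p').
  rewrite -evE; apply: (witP _ _ _ x); rewrite evE => p'x; apply: px.
  by rewrite pE; apply/sat_rename; move: p'x; rewrite -oE.
apply; rewrite -oE; apply/sat_rename; rewrite -pE.
by have /IH := h (exist _ (ev s) Ms); rewrite E.
Qed.

(** * Reducts *)

Section Translation.
Variables (L0 : language) (rel0 : relational L0) (L : language) (P : Type).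
Variables (theta : forall r : rsym L0, formula L ('I_(rarity r) + P)).
(* Defines the complement of F, in the variable [None]. *)
Variable (outF : formula L (option P)).

Definition var_of V (t : term L0 V) : V :=
  match t with Var x => x | App f _ => False_rect _ (rel0 f) end.

(** Quantifiers are relativized to the complement of [F]. The parameters of [theta] stay variables
    in [P], so that one translation serves every interpretation [pi]. *)
Fixpoint translate (V : Type) (p : formula L0 V) : formula L (V + P) :=
  match p with
  | Bot => Bot
  | Eq t u => Eq (Var (inl (var_of t))) (Var (inl (var_of u)))
  | Rel r a => rename (sumv (inl \o (@var_of V \o a)) inr) (theta r)
  | Imp p q => Imp (translate p) (translate q)
  | All p => All (Imp (rename (omap inr) outF)
      (rename (sumv (omap inl) (Some \o inr)) (translate p)))
  end.

Variables (U : Type) (S : structure L U) (pi : P -> U) (F : set U).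
Hypothesis outFP : forall x, sat S (oapp pi x) outF <-> ~ F x.

Definition reduct : structure L0 (~` F) :=
  @induced_structure L0 rel0 L U S F
    (fun r => rename (sumv inl (inr \o pi)) (theta r)).

Lemma teval_var_of V (v : V -> ~` F) t : teval reduct v t = v (var_of t).
Proof. by case: t => [//|f a]; case: (rel0 f). Qed.

Lemma sat_translate V (v : V -> ~` F) p :
  sat reduct v p <-> sat S (sumv (val \o v) pi) (translate p).
Proof.
elim: p v => [V'|V' t u|V' r a|V' p IHp q IHq|V' p IH] v; rewrite /= -/reduct.
- by [].
- by rewrite !teval_var_of; split=> [->//|/val_inj].
- rewrite /usat !sat_rename.
  match goal with |- sat _ ?f _ <-> sat _ ?g _ => suff -> : f = g by [] end.
  apply: funext => -[i|c] //=.
  by rewrite teval_var_of.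
- by have := IHp v; have := IHq v; tauto.
have E (x : ~` F) : (fun o => if o is Some y then sumv (val \o v) pi y else val x)
    \o sumv (omap inl) (Some \o inr) =
  sumv (val \o (fun o => if o is Some y then v y else x)) pi.
  by apply: funext => -[[y|]|c].
have Eo x : (fun o => if o is Some y then sumv (val \o v) pi y else x) \o omap inr
   = oapp pi x by apply: funext => -[].
split=> h x.
  rewrite !sat_rename Eo => /outFP Fx.
  by have /IH := h (exist _ x (mem_set Fx)); rewrite -E.
apply/IH; rewrite -E; apply/sat_rename; apply: h.
apply/sat_rename; rewrite Eo; apply/outFP; exact: set_mem (valP x).
Qed.

(** The filter is pushed forward to tuples of [U] and realized over the small set [D] of all
    parameters involved. Keeping track of L-formulas over [B] as well lets one tuple realize an
    L0-type and inherit L-properties of the filter. *)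
Lemma realize_reduct K n (A : set (~` F)) (B : set U)
    (G : set_system ('I_n -> ~` F)) :
  lesser K nat -> saturated K S -> small K (range pi) ->
  small K A -> small K B -> ProperFilter G ->
  exists a : 'I_n -> ~` F,
    (forall q : formula L0 ('I_n + A), G [set b | psat reduct b q] ->
       psat reduct a q) /\
    (forall q : formula L ('I_n + B), G [set b : 'I_n -> ~` F | psat S (val \o b) q] ->
       psat S (val \o a) q).
Proof.
move=> Kn Ssat spi sA sB PG; set D := range pi `|` (val @` A `|` B).
have sD : small K D.
  by do 2?apply: small_setU => //; exact: small_image.
have inD_pi c : pi c \in D by apply/mem_set; left; exists c.
have inD_A (x : A) : val (val x) \in D.
  by apply/mem_set; right; left; exists (val x) => //; exact: set_mem (valP x).
have inD_B (x : B) : val x \in D by apply/mem_set; do 2!right; exact: set_mem (valP x).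
have [a aP] := realize_filter (F := (fun b : 'I_n -> ~` F => val \o b) @ G) Ssat sD _.
(* The filter lives on tuples outside [F], and [outF] expresses this by a formula over [D]. *)
have aF i : a i \in ~` F.
  apply/mem_set/outFP.
  have := aP (rename (oapp (fun c => inr (exist _ (pi c) (inD_pi c))) (inl i)) outF).
  have E b : sumv b (@set_val _ D) \o
     oapp (fun c => inr (exist _ (pi c) (inD_pi c))) (inl i) = oapp pi (b i).
    by apply: funext => -[].
  rewrite /psat sat_rename E; apply.
  rewrite fmapE; apply: filterS filterT => b _ /=.
  rewrite sat_rename E; apply/outFP; exact: set_mem (valP (b i)).
pose a0 i : ~` F := exist _ (a i) (aF i).
have a0E : val \o a0 = a by apply: funext.
exists a0; split=> q Gq.
  pose k : ('I_n + A) + P -> 'I_n + D := sumv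
    (sumv inl (fun x => inr (exist _ (val (val x)) (inD_A x))))
    (fun c => inr (exist _ (pi c) (inD_pi c))).
  have E b : sumv (val \o b) (@set_val _ D) \o k =
      sumv (val \o sumv b (@set_val _ A)) pi.
    by apply: funext => -[[i|x]|c].
  apply/sat_translate; rewrite -E -sat_rename a0E; apply: aP.
  rewrite fmapE; apply: filterS Gq => b /=.
  by rewrite /psat sat_rename E => /sat_translate.
pose k : 'I_n + B -> 'I_n + D := sumv inl (fun x => inr (exist _ (val x) (inD_B x))).
have E b : sumv b (@set_val _ D) \o k = sumv b (@set_val _ B).
  by apply: funext => -[].
rewrite a0E /psat -E -sat_rename; apply: aP.
by rewrite fmapE; apply: filterS Gq => b /=; rewrite /psat sat_rename E.
Qed.

Lemma saturated_reduct K :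
  lesser K nat -> saturated K S -> small K (range pi) -> saturated K reduct.
Proof.
move=> Kn Ssat spi A sA n p.
pose G := filter_from (type_set p) (fun q => [set b | psat reduct b q]).
have FG : Filter G.
  apply: filter_from_filter => [|q1 q2 p1 p2].
    have [h|/type_sat[a ha]] := (type_setP p).2 Top; first by exists Top.
    by case: ha.
  by exists (And q1 q2) => [|b]; [exact: type_And|rewrite /= /psat sat_And].
have PG : ProperFilter G by apply: filter_from_proper => q /type_sat.
have s0 : small K (set0 : set U).
  by apply: small_sub spi; exact: sub0set.
have [a [aP _]] := realize_reduct Kn Ssat spi sA s0 PG.
by exists a; apply/esym/type_ext => q pq; apply: aP; exists q.
Qed.

End Translation.

(** The formula is chosen before the structure, so that it defines the complement of the image of
    [C] in the original monster model and in the new one alike. *)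
Lemma avoid_formula L P (C : set P) : finite_set C ->
  exists p : formula L (option P), forall U (S : structure L U) (pi : P -> U) x,
    sat S (oapp pi x) p <-> ~ (pi @` C) x.
Proof.
move=> Cfin; have [q qP] := finite_conj (finite_image
  (fun c => Neg (@Eq L _ (Var None) (Var (Some c)))) Cfin).
exists q => U S pi x; rewrite qP; split=> [h [c Cc cx]|h _ [c Cc <-] /= xc].
  by apply: (h _ (ex_intro2 _ _ c Cc erefl)).
by apply: h; exists c.
Qed.

Lemma finite_small K X (A : set X) : lesser K nat -> finite_set A -> small K A.
Proof.
move=> Kn /finite_range[k [f ->]]; apply: small_image; apply/lesser_setT.
by apply: lesser_embeds Kn; exists val; exact: val_inj.
Qed.

(** [is_reduct] speaks of one monster model, [dfs_trivial] of all. The parameters of the reduct form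
    a small set [P]; its elementary copy in [S] satisfies the same translations of the axioms of
    [T0]. *)
Lemma reduct_transfer K L (T : theory L) L0 (T0 : theory L0) U (S : structure L U) :
  complete_theory T -> is_reduct K T T0 -> monster K T S ->
  exists (rel0 : relational L0) (P : Type)
    (theta : forall r : rsym L0, formula L ('I_(rarity r) + P))
    (outF : formula L (option P)) (pi : P -> U) (F : set U),
  [/\ finite_set F, forall x, sat S (oapp pi x) outF <-> ~ F x,
      small K (range pi) & models (reduct rel0 theta S pi F) T0].
Proof.
move=> Tc [rel0 [Kr _ [U1 [S1 [[M1 _ _ _ _] [F1 F1fin [theta1 M0]]]]]]].
move=> [M /lesser_setT Kn _ _ Ssat].
have [[u1] _] := M1.
set P : set U1 := F1 `|` \bigcup_r (inr @^-1` fv (theta1 r)).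
have sP : small K P.
  apply: small_setU => //; first exact: finite_small.
  (* Each [theta1 r] has finitely many parameters, so they are all enumerated by [rsym L0 * nat],
     with [u1] as the value for indices out of range. *)
  have /choice[kf kfP] : forall r : rsym L0, exists kf : {k & 'I_k -> U1},
      inr @^-1` fv (theta1 r) = range (projT2 kf).
    move=> r; have [|k [f fP]] := @finite_range U1 (inr @^-1` fv (theta1 r)).
      by apply: finite_preimage (fv_finite _) => ? ? _ _ [].
    by exists (existT _ k f).
  pose g (ri : rsym L0 * nat) := if insub ri.2 is Some i then projT2 (kf ri.1) i else u1.
  apply: (@small_sub _ _ _ (range g)).
    move=> x [r _]; rewrite kfP => -[i _ <-]; exists (r, val i) => //.
    by rewrite /g valK.
  apply: small_image; apply/lesser_setT; apply: lesser_prod => //.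
  exact/lesser_setT.
have /(_ _)/cid-thetaP r : exists q : formula L ('I_(rarity r) + P),
    theta1 r = rename (sumv inl (inr \o val)) q.
  apply: rename_factor => -[i|x] rx; first by exists (inl i).
  have Px : x \in P by apply/mem_set; right; exists r.
  by exists (inr (exist _ x Px)).
pose theta r := projT1 (thetaP r).
have theta1E : theta1 = fun r => rename (sumv inl (inr \o val)) (theta r).
  by apply: functional_extensionality_dep => r; exact: projT2 (thetaP r).
have F1P x : F1 x -> x \in P by move=> Fx; apply/mem_set; left.
pose C : set P := val @^-1` F1.
have Cfin : finite_set C by apply: finite_preimage => // ? ? _ _; exact: val_inj.
have [outF outFP] := avoid_formula L Cfin.
have out1 x : sat S1 (oapp val x) outF <-> ~ F1 x.
  rewrite outFP; suff -> : (val @` C) x = F1 x by [].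
  apply/propext; split=> [[c Cc <-] //|Fx].
  by exists (exist _ x (F1P x Fx)).
have [j jP] := elementary_transfer Tc M1 M Ssat sP.
exists rel0, P, theta, outF, j, (j @` C); split.
- exact: finite_image.
- exact: outFP.
- by apply: small_image; apply/lesser_setT; apply/smallE.
move: M0; rewrite theta1E => -[[[x xF]] M0]; split.
  (* The new universe is nonempty: the existence of a point outside [F1] is transferred by [jP]. *)
  have /existsNP[y /contrapT/outFP yF] : ~ sat S j (All (Neg outF)).
    rewrite -jP => /(_ x); apply; apply/out1; exact: set_mem xF.
  by constructor; exists y; apply/mem_set.
move=> p T0p; apply/(sat_translate rel0 theta (outFP _ S j)).
have := M0 p T0p => /(sat_translate rel0 theta out1).
pose w (z : void + P) : P := match z with inl v => of_void P v | inr c => c end.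
have E X (v : void -> X) (f : P -> X) : sumv v f = f \o w.
  by apply: funext => -[[]|].
by rewrite !E => h; apply/sat_rename/jP/sat_rename.
Qed.

Lemma reduct_monster K L0 (T0 : theory L0) (rel0 : relational L0) L P
    (theta : forall r : rsym L0, formula L ('I_(rarity r) + P))
    (outF : formula L (option P)) U (S : structure L U) (pi : P -> U) (F : set U) :
  lesser K nat -> small K [set: rsym L0] -> saturated K S ->
  (forall x, sat S (oapp pi x) outF <-> ~ F x) ->
  small K (range pi) -> models (reduct rel0 theta S pi F) T0 ->
  monster K T0 (reduct rel0 theta S pi F).
Proof.
move=> Kn Kr Ssat outFP spi M0; split=> //; first exact/lesser_setT.
  apply/lesser_setT; apply: lesser_embeds Kn.
  by exists (fun f => False_rect _ (rel0 f)) => f; case: (rel0 f).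
exact: saturated_reduct outFP _ Kn Ssat spi.
Qed.

(** * Keisler measures *)

Lemma usat_And L U (S : structure L U) n (a : 'I_n -> U) p q :
  usat S a (And p q) <-> usat S a p /\ usat S a q.
Proof. exact: sat_And. Qed.

Lemma usat_Or L U (S : structure L U) n (a : 'I_n -> U) p q :
  usat S a (Or p q) <-> usat S a p \/ usat S a q.
Proof. exact: sat_Or. Qed.

Section Measure.
Variables (R : realType) (L : language) (U : Type) (S : structure L U) (n : nat).
Variable mu : keisler_measure R S n.

Lemma kmeasure_disjoint p q r : (forall a, ~ (usat S a p /\ usat S a q)) ->
  (forall a, usat S a r <-> usat S a p \/ usat S a q) -> mu r = mu p + mu q.
Proof.
by move=> pq rpq; rewrite -kmeasureU //; apply: kmeasure_equiv => a; rewrite rpq usat_Or.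
Qed.

Lemma kmeasure_Neg p : mu (Neg p) = 1 - mu p.
Proof.
have : mu Top = mu p + mu (Neg p).
  apply: kmeasure_disjoint => a; first by move=> [h]; apply.
  by split=> [_|_ []]; exact: (EM (usat S a p)).
by rewrite kmeasureT => ->; rewrite addrAC subrr add0r.
Qed.

Lemma kmeasure_split p q : mu p = mu (And p q) + mu (And p (Neg q)).
Proof.
apply: kmeasure_disjoint => a; rewrite !usat_And; first by move=> [[_ h] [_]]; apply.
by have := EM (usat S a q); rewrite {3}/usat /= -/(usat S a q); tauto.
Qed.

Lemma kmeasure_le p q : (forall a, usat S a p -> usat S a q) -> mu p <= mu q.
Proof.
move=> pq; rewrite (kmeasure_split q p).
rewrite (@kmeasure_equiv _ _ _ _ _ mu (And q p) p) ?lerDl ?kmeasure_ge0 // => a.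
by rewrite usat_And; split=> [[]//|h]; split=> //; exact: pq.
Qed.

Lemma kmeasure_Bot p : (forall a, ~ usat S a p) -> mu p = 0.
Proof.
move=> p0; have := kmeasureT mu; rewrite (@kmeasure_equiv _ _ _ _ _ mu Top (Neg p)).
  by rewrite kmeasure_Neg; lra.
by move=> a; split=> [_|_ []]; exact: (p0 a).
Qed.

Lemma kmeasure_And p q : mu p + mu q - 1 <= mu (And p q).
Proof.
have := kmeasure_split p q; have := kmeasure_Neg q.
suff : mu (And p (Neg q)) <= mu (Neg q) by lra.
by apply: kmeasure_le => a /usat_And [].
Qed.

Lemma kmeasure_le_diff p q : mu p <= mu q + mu (And p (Neg q)).
Proof.
rewrite {1}(kmeasure_split p q) lerD2r.
by apply: kmeasure_le => a /usat_And [].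
Qed.

(** If the two values differed, some solution in [M] of one instance but not of the other would
    separate the types of [b] and [c] over [M]. *)
Lemma finitely_satisfiable_invariant (M : set U) m
    (p : formula L ('I_n + 'I_m)) (b c : 'I_m -> U) :
  finitely_satisfiable_in mu M ->
  (forall q : formula L ('I_m + M), psat S b q -> psat S c q) ->
  mu (inst p b) = mu (inst p c).
Proof.
move=> fs bc.
have instE a d (p' : formula L ('I_n + 'I_m)) : usat S (@set_val _ M \o a) (inst p' d) <->
    psat S d (rename (sumv (inr \o a) inl) p').
  rewrite /usat /psat !sat_rename.
  match goal with |- sat _ ?f _ <-> sat _ ?g _ => suff -> : f = g by [] end.
  by apply: funext => -[].
have bc' (q : formula L ('I_m + M)) : psat S c q -> psat S b q.
  by move=> cq; apply: contrapT => bq; have /(_ cq) := bc (Neg q) bq.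
have key d1 d2 : (forall q : formula L ('I_m + M), psat S d1 q -> psat S d2 q) ->
    mu (inst p d1) <= mu (inst p d2).
  move=> d12; apply: le_trans (kmeasure_le_diff _ (inst p d2)) _.
  rewrite gerDl leNgt; apply/negP => /fs[a /usat_And[/instE h1 h2]].
  by apply: h2; apply/instE; apply: d12.
by apply/eqP; rewrite eq_le !key.
Qed.

End Measure.

(** * The Stone topology and local definability *)

Lemma type_inv_And L U (S : structure L U) (A : set U) n (t : type_space S A n) p q :
  type_set t (And p q) -> type_set t p /\ type_set t q.
Proof.
move=> tpq; split.
  have [//|h] := (type_setP t).2 p; have [a] := type_sat (type_And tpq h).
  by rewrite /psat !sat_And => -[[? _]] /=; tauto.
have [//|h] := (type_setP t).2 q; have [a] := type_sat (type_And tpq h).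
by rewrite /psat !sat_And => -[[_ ?]] /=; tauto.
Qed.

(** A finite intersection of subbasic sets is the basic open set of a conjunction, and the empty one
    that of [Top]. *)
Lemma nbhs_type L U (S : structure L U) (A : set U) n (t : type_space S A n)
    (W : set (type_space S A n)) :
  nbhs t W <-> exists2 q, type_set t q & basic_open q `<=` W.
Proof.
rewrite nbhsE; split=> [[_ [[B sB <-] [C BC Ct]] sub]|[q tq sub]].
  have {}sub : C `<=` W by move=> x Cx; apply: sub; exists C.
  have [D sD DC] := sB _ BC; rewrite -DC in sub Ct.
  suff [q tq qD] : exists2 q, type_set t q &
      forall x, type_set x q -> forall i, i \in enum_fset D -> i x.
    by exists q => // x xq; apply: sub; apply: qD.
  have : forall i, i \in enum_fset D -> range (@basic_open L U S A n) i /\ i t.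
    by move=> i iD; split; [exact: set_mem (sD _ iD)|apply: Ct].
  elim: (enum_fset D) => [_|i l IH h].
    have [tT|/type_sat[a []//]] := (type_setP t).2 Top.
    by exists Top.
  have [[q _ qi] it] := h i (mem_head _ _).
  have [|q' tq' q'l] := IH; first by move=> j jl; apply: h; rewrite inE jl orbT.
  exists (And q q') => [|x /type_inv_And [xq xq'] j].
    by apply: type_And => //; move: it; rewrite -qi.
  by rewrite inE => /orP[/eqP ->|]; [rewrite -qi|exact: q'l].
exists (basic_open q) => //; split=> //.
exists [set basic_open q]; last by rewrite bigcup_set1.
move=> _ ->; exists [fset (basic_open q : set (type_space S A n))]%fset.
  by move=> i /fset1P ->; apply/mem_set; exists q.
by rewrite set_fset1 bigcap_set1.
Qed.

(** This is continuity in epsilon form. An arbitrary type [V] of parameter variables is allowed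
    because [pullback] has parameters in [V + P]. *)
Definition locally_definable (R : realType) L U (S : structure L U) n
    (mu : keisler_measure R S n) (M : set U) : Prop :=
  forall V (p : formula L ('I_n + V)) (b : V -> U) (e : R), 0 < e ->
  exists2 chi : formula L (V + M), sat S (sumv b (@set_val U M)) chi &
    forall c, sat S (sumv c (@set_val U M)) chi ->
    `|mu (rename (sumv inl (inr \o b)) p) - mu (rename (sumv inl (inr \o c)) p)| < e.

Lemma definable_locally (R : realType) L U (S : structure L U) n
    (mu : keisler_measure R S n) (M : set U) :
  definable_over mu M -> locally_definable mu M.
Proof.
move=> defmu V p b e e0; have [k [f [p' ->]]] := rename_factor_params p.
have E c : mu (rename (sumv inl (inr \o c)) (rename (sumv inl (inr \o f)) p')) =
    mu (inst p' (c \o f)).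
  apply: kmeasure_equiv => a; rewrite /usat !sat_rename.
  match goal with |- sat _ ?f _ <-> sat _ ?g _ => suff -> : f = g by [] end.
  by apply: funext => -[].
have [F [Fc FE]] := defmu _ p'.
have /cvgrPdist_lt/(_ _ e0)/nbhs_type[chi bchi chiP] := Fc (tp S M (b \o f)).
have E2 c : sumv c (@set_val U M) \o sumv (inl \o f) inr = sumv (c \o f) (@set_val U M).
  by apply: funext => -[].
exists (rename (sumv (inl \o f) inr) chi); first by rewrite sat_rename E2.
move=> c; rewrite sat_rename E2 => cchi; rewrite !E -!FE.
exact: (chiP (tp S M (c \o f))).
Qed.

(** Saturation provides a realization [re t] of each type. The local bounds give continuity and, for
    all [e] at once, independence of the realization. *)
Lemma locally_definable_over K (R : realType) L U (S : structure L U) n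
    (mu : keisler_measure R S n) (M : set U) :
  saturated K S -> small K M ->
  (forall m (p : formula L ('I_n + 'I_m)) (b : 'I_m -> U) (e : R), 0 < e ->
   exists2 chi : formula L ('I_m + M), psat S b chi &
     forall c, psat S c chi -> `|mu (inst p b) - mu (inst p c)| < e) ->
  definable_over mu M.
Proof.
move=> Ssat sM loc m p; have /choice[re reP] := Ssat M sM m.
exists (fun t => mu (inst p (re t))); split=> [t|b].
  apply/(cvgrPdist_lt (F := nbhs t)) => e e0; have [chi tchi chiP] := loc m p (re t) e e0.
  have reE t' : psat S (re t') chi <-> type_set t' chi by rewrite -{2}[t']reP.
  apply/nbhs_type; exists chi; first exact/reE.
  by move=> t' /reE; exact: chiP.
apply/eqP; rewrite -subr_eq0 -normr_eq0 eq_le normr_ge0 andbT.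
apply/ler_addgt0Pl => e e0; rewrite addr0.
have [chi bchi chiP] := loc m p (re (tp S M b)) e e0.
apply/ltW/chiP; suff : type_set (tp S M b) chi by [].
by rewrite -[tp S M b]reP.
Qed.

(** * The measure induced on the reduct by one coordinate *)

Section Localization.
Variables (L0 : language) (rel0 : relational L0) (L : language) (P : Type).
Variables (theta : forall r : rsym L0, formula L ('I_(rarity r) + P)).
Variable (outF : formula L (option P)).
Variables (U : Type) (S : structure L U) (pi : P -> U) (F : set U).
Hypothesis outFP : forall x, sat S (oapp pi x) outF <-> ~ F x.
Variables (R : realType) (n : nat) (mu : keisler_measure R S n) (i : 'I_n).

Let S0 := reduct rel0 theta S pi F.

Definition outside : formula L ('I_n + U) :=
  rename (oapp (inr \o pi) (inl i)) outF.

Lemma usat_outside a : usat S a outside <-> ~ F (a i).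
Proof.
rewrite /usat sat_rename -outFP.
match goal with |- sat _ ?f _ <-> sat _ ?g _ => suff -> : f = g by [] end.
by apply: funext => -[].
Qed.

(** [p] is read on the i-th coordinate, under the condition that it lies outside [F]. Keeping [V]
    and [P] as variables makes definability of [mu] applicable. *)
Definition pullback V (p : formula L0 ('I_1 + V)) : formula L ('I_n + (V + P)) :=
  And (rename (oapp (inr \o inr) (inl i)) outF)
    (rename (sumv (sumv (fun=> inl i) (inr \o inl)) (inr \o inr))
       (translate rel0 theta outF p)).

Lemma usat_pullback V (p : formula L0 ('I_1 + V)) (v : V -> ~` F) a :
  usat S a (rename (sumv inl (inr \o sumv (val \o v) pi)) (pullback p)) <->
  exists h : a i \in ~` F, sat S0 (sumv (fun=> exist _ (a i) h) v) p.
Proof.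
rewrite /usat sat_rename sat_And !sat_rename.
set f := (X in sat S X outF); set g := (X in _ /\ sat S X _).
have -> : f = oapp pi (a i) by apply: funext => -[].
have E h : g = sumv (val \o sumv (fun=> exist _ (a i) h : ~` F) v) pi.
  by apply: funext => -[[?|?]|?].
split=> [[/outFP/mem_set h]|[h ph]].
  by exists h; apply/(sat_translate rel0 theta outFP); rewrite -E.
split; first by apply/outFP; exact: set_mem h.
by rewrite (E h); apply/(sat_translate rel0 theta outFP).
Qed.

Definition localize (p : formula L0 ('I_1 + ~` F)) : formula L ('I_n + U) :=
  rename (sumv inl (inr \o sumv (@set_val _ (~` F)) pi)) (pullback p).

Lemma usat_localize p a : usat S a (localize p) <->
  exists h : a i \in ~` F, usat S0 (fun=> exist _ (a i) h) p.
Proof. exact: (usat_pullback p id). Qed.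

Hypothesis out_pos : 0 < mu outside.

Let nu0 p := mu (localize p) / mu outside.

Let nu0_equiv p q : (forall a, usat S0 a p <-> usat S0 a q) -> nu0 p = nu0 q.
Proof.
move=> pq; rewrite /nu0 (@kmeasure_equiv _ _ _ _ _ mu _ (localize q)) // => a.
by rewrite !usat_localize; split=> -[h hp]; exists h; apply/pq.
Qed.

Let nu0_ge0 p : 0 <= nu0 p.
Proof. by rewrite divr_ge0 ?kmeasure_ge0. Qed.

Let nu0T : nu0 Top = 1.
Proof.
rewrite /nu0 (@kmeasure_equiv _ _ _ _ _ mu _ outside) ?divff ?gt_eqF // => a.
rewrite usat_localize usat_outside; split=> [[h _]|h]; first exact: set_mem h.
by exists (mem_set h).
Qed.

Let nu0U p q : (forall a, ~ (usat S0 a p /\ usat S0 a q)) ->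
  nu0 (Or p q) = nu0 p + nu0 q.
Proof.
move=> pq; rewrite /nu0 -mulrDl; congr (_ / _); apply: kmeasure_disjoint => a.
  rewrite !usat_localize => -[[h hp] [h' hq]]; rewrite (Prop_irrelevance h' h) in hq.
  by apply: (pq (fun=> exist _ (a i) h)).
rewrite !usat_localize; split=> [[h /usat_Or[hp|hq]]|[[h hp]|[h hq]]].
- by left; exists h.
- by right; exists h.
- by exists h; apply/usat_Or; left.
- by exists h; apply/usat_Or; right.
Qed.

(* The L0-measure induced on the i-th coordinate, conditioned on x_i not in F. *)
Definition localization : keisler_measure R S0 1 :=
  KeislerMeasure nu0_equiv nu0_ge0 nu0T nu0U.

Lemma localization_inst m (p : formula L0 ('I_1 + 'I_m)) (b : 'I_m -> ~` F) :
  localization (inst p b) =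
  mu (rename (sumv inl (inr \o sumv (val \o b) pi)) (pullback p)) / mu outside.
Proof.
congr (_ / _); apply: kmeasure_equiv => a; rewrite usat_localize usat_pullback.
have E h : sumv (fun=> exist _ (a i) h : ~` F) id \o sumv inl (inr \o b) =
    sumv (fun=> exist _ (a i) h) b by apply: funext => -[].
by split=> -[h hp]; exists h; move: hp; rewrite /usat sat_rename E.
Qed.

Lemma localization_le p q : (forall a, usat S a p -> usat S a (localize q)) ->
  mu p <= mu outside * localization q.
Proof. by move=> pq; rewrite mulrC divfK ?gt_eqF //; exact: kmeasure_le. Qed.

(** The i-th coordinate of a witness in [M] lies outside [F], hence in [M0]. *)
Lemma localization_satisfiable (M : set U) (M0 : set (~` F)) :
  finitely_satisfiable_in mu M -> val @^-1` M `<=` M0 ->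
  finitely_satisfiable_in localization M0.
Proof.
move=> fs MM0 p; rewrite pmulr_lgt0 ?invr_gt0 // => /fs[a].
move=> /usat_localize[h hp].
have aM0 : exist _ (\val (a i)) h \in M0.
  by apply/mem_set/MM0; exact: set_mem (valP (a i)).
by exists (fun=> exist (fun x => x \in M0) _ aM0).
Qed.

(* Finite satisfiability makes the measure of phi(x, b) a function of the
   L0-type of b over M0. If it were not continuous there, saturation would give
   a tuple of the same L0-type that violates the definability of mu in L. *)
Lemma localization_definable K (M : set U) (M0 : set (~` F)) :
  lesser K nat -> saturated K S -> small K (range pi) -> small K M ->
  small K M0 -> definable_over mu M -> finitely_satisfiable_in localization M0 ->
  definable_over localization M0.
Proof.
move=> Kn Ssat spi sM sM0 /definable_locally defmu fs.
have S0sat : saturated K S0 by exact: saturated_reduct outFP _ Kn Ssat spi.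
apply: (locally_definable_over S0sat sM0) => m p b e e0.
apply: contrapT => /forall2NP nochi.
pose bad : set ('I_m -> ~` F) :=
  [set c | e <= `|localization (inst p b) - localization (inst p c)|].
(* As no [chi] works, the L0-type of [b] over [M0] is finitely satisfiable in [bad]. *)
pose G := filter_from (fun q : formula L0 ('I_m + M0) => psat S0 b q)
  (fun q => [set c | psat S0 c q] `&` bad).
have FG : Filter G.
  apply: filter_from_filter => [|q1 q2 b1 b2]; first by exists Top.
  exists (And q1 q2) => [|c]; first exact/sat_And.
  by move=> [/sat_And[c1 c2] cb]; split; split.
have PG : ProperFilter G.
  apply: filter_from_proper => q bq; have [//|/existsNP[c /not_implyP[cq /negP]]] := nochi q.
  by rewrite -leNgt => cb; exists c.
have sD : small K (M `|` range pi) by exact: small_setU.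
have [c [c0 c1]] := realize_reduct rel0 theta outFP Kn Ssat spi sM0 sD PG.
have bc : localization (inst p b) = localization (inst p c).
  by apply: finitely_satisfiable_invariant fs _ => q bq; apply: c0; exists q => // ? [].
(* The factor [mu outside] compensates the normalization of [localization]. *)
have e1 : 0 < e * mu outside by rewrite mulr_gt0.
have [chi cchi chiP] := defmu _ (pullback p) (sumv (val \o c) pi) _ e1.
have piD x : pi x \in M `|` range pi by apply/mem_set; right; exists x.
have MD (x : M) : val x \in M `|` range pi.
  by apply/mem_set; left; exact: set_mem (valP x).
pose k : ('I_m + P) + M -> 'I_m + (M `|` range pi)%classic := sumv
  (sumv inl (fun x => inr (exist _ (pi x) (piD x))))
  (fun x => inr (exist _ (val x) (MD x))).
have kE (d : 'I_m -> U) : sumv d (@set_val _ (M `|` range pi)) \o k =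
    sumv (sumv d pi) (@set_val _ M) by apply: funext => -[[]|].
(* By [bc], a tuple in [bad] is as far from [c] as from [b], so it violates [chi]. Thus [Neg chi]
   holds along the filter and passes to [c], contradicting [cchi]. *)
have : psat S (val \o c) (rename k (Neg chi)).
  apply: c1; exists Top => // d [_ dbad].
  apply/(@sat_rename _ _ _ _ _ k _ (Neg chi)); rewrite kE => /chiP.
  apply/negP; rewrite -leNgt -ler_pdivlMr //.
  apply: le_trans dbad _; rewrite bc !localization_inst -mulrBl normrM.
  by rewrite [X in _ * X]gtr0_norm ?invr_gt0.
by rewrite /psat sat_rename kE; apply.
Qed.

End Localization.

(** * Tightness of the marginals *)

Lemma coordinate_formula L U n (i : 'I_n) (A : set U) : finite_set A ->
  exists p : formula L ('I_n + U), forall (S : structure L U) a,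
    usat S a p <-> A (a i).
Proof.
move=> /(avoid_formula L)[q qP].
exists (Neg (rename (oapp inr (inl i)) q)) => S a.
rewrite /usat sat_Neg sat_rename.
have -> : sumv a id \o oapp inr (inl i) = oapp id (a i).
  by apply: funext => -[].
rewrite qP image_id; split=> [h|Aa]; first exact: contrapT.
by apply.
Qed.

(** The localization is dfs, hence atomic by assumption on [T0]; [A] consists of [F] and finitely
    many of the atoms. *)
Lemma coordinate_tight K (R : realType) L (T : theory L) L0 (T0 : theory L0)
    U (S : structure L U) n (mu : keisler_measure R S n) (i : 'I_n) e :
  complete_theory T -> is_reduct K T T0 -> dfs_trivial K R T0 ->
  monster K T S -> Defs.dfs K mu -> 0 < e ->
  exists A p, [/\ finite_set A, forall a, usat S a p <-> A (a i) & 1 - e <= mu p].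
Proof.
move=> Tc red triv0 monS [M [sM _ defmu fsmu]] e0.
have [rel0 [P [theta [outF [pi [F [Ffin outFP spi M0]]]]]]] :=
  reduct_transfer Tc red monS.
have [_ [/lesser_setT Kr0 _ _]] := red.
have [_ /lesser_setT Kn _ _ Ssat] := monS.
(* If the i-th coordinate lies in [F] almost surely, there is nothing to normalize and [F] itself
   serves. *)
have [out0|out_pos] := eqVneq (mu (outside outF pi i)) 0.
  have [p pP] := coordinate_formula L i Ffin.
  exists F, p; split=> //; suff : mu (Neg p) = 0 by rewrite kmeasure_Neg; lra.
  rewrite -out0; apply: kmeasure_equiv => a; rewrite (usat_outside outFP).
  by rewrite -(pP S).
have {}out_pos : 0 < mu (outside outF pi i) by rewrite lt_neqAle eq_sym out_pos kmeasure_ge0.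
pose nu := localization rel0 theta outFP out_pos.
have sr : small K [set: rsym L0] by apply/lesser_setT.
have monS0 := reduct_monster Kn sr Ssat outFP spi M0.
have sM' : small K (val @^-1` M : set (~` F)).
  move: sM; rewrite !smallE; apply: lesser_embeds.
  have h (x : (val @^-1` M : set (~` F))) : val (val x) \in M.
    by apply/mem_set; exact: set_mem (valP x).
  exists (fun x => exist (fun y => y \in M) _ (h x)) => x y [].
  by move=> /val_inj/val_inj.
(* The trace of [M] on the reduct need not be elementary there, so it is enlarged. *)
have [M1 [MM1 sM1 elM1]] := lowenheim_skolem (reduct rel0 theta S pi F)
  rel0 M0.1 Kn sr sM'.
have fsnu : finitely_satisfiable_in nu M1.
  exact: localization_satisfiable fsmu MM1.
have defnu : definable_over nu M1.
  exact: localization_definable Kn Ssat spi sM sM1 defmu fsnu.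
have [|r [c [r0 r1 rc]]] := triv0 _ _ monS0 1%N isT nu.
  by exists M1.
have [N _ /(_ N (leqnn N)) rN] := (cvgrPdist_le _ _).1 r1 e e0.
pose C := (fun k => c k ord0) @` `I_N.
have Cfin : finite_set C by apply: finite_image; exact: finite_II.
have [q qP] := coordinate_formula L0 (@ord0 0) Cfin.
(* The first [N] atoms satisfy [q], so all later partial sums for [q], and their limit, stay above
   this sum. *)
have qN : \sum_(0 <= k < N) r k <= nu q.
  apply: (cvgr_to_ge (rc q)); near=> m.
  have Nm : (N <= m)%N by near: m; exists N.
  rewrite [leRHS](big_cat_nat _ (n := N)) //=; apply: ler_wpDr.
    by apply: sumr_ge0 => k _; rewrite mulr_ge0.
  rewrite big_nat [leRHS]big_nat; apply: ler_sum => k /andP[_ kN].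
  by rewrite /dirac_at asboolT ?mulr1 //; apply/(qP _ (c k)); exists k.
have [p pP] : exists p : formula L ('I_n + U),
    forall S a, usat S a p <-> (F `|` val @` C) (a i).
  by apply: coordinate_formula; rewrite finite_setU; split=> //; exact: finite_image.
exists (F `|` val @` C), p; split=> //.
  by rewrite finite_setU; split=> //; exact: finite_image.
(* Outside [A], the coordinate avoids both [F] and the chosen atoms. *)
have : mu (Neg p) <= mu (outside outF pi i) * nu (Neg q).
  apply: localization_le => a ap; apply/(usat_localize rel0 theta outFP i (Neg q)).
  have ai : a i \in ~` F by apply/mem_set => Fa; apply: ap; apply/pP; left.
  exists ai => /(qP _ (fun=> exist _ (a i) ai)) Cai; apply: ap; apply/pP; right.
  by exists (exist _ (a i) ai).
have mu1 : mu (outside outF pi i) <= 1.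
  by rewrite -(kmeasureT mu); apply: kmeasure_le => a _ [].
have nu0 := kmeasure_ge0 nu (Neg q).
have : nu (Neg q) <= e.
  rewrite kmeasure_Neg; move: rN; rewrite ler_norml => /andP[_]; lra.
rewrite (kmeasure_Neg mu p); nra.
Unshelve. all: by end_near.
Qed.

Lemma finite_functions (U : Type) n (A : set U) : finite_set A ->
  finite_set [set a : 'I_n -> U | forall i, A (a i)].
Proof.
move=> /finite_range[k [f ->]].
apply: (@sub_finite_set _ _ (range (fun (g : {ffun 'I_n -> 'I_k}) i => f (g i)))).
  move=> a /= af; have /choice[g gP] : forall i, exists j, f j = a i.
    by move=> i; have [j _ <-] := af i; exists j.
  by exists (finfun g) => //; apply: funext => i; rewrite ffunE.
by apply: finite_image; exact: finite_finset.
Qed.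

Lemma point_formula L U n (a : 'I_n -> U) :
  exists p : formula L ('I_n + U), forall (S : structure L U) b,
    usat S b p <-> b = a.
Proof.
have [q qP] := finite_conj (finite_image
  (fun i => @Eq L _ (Var (inl i)) (Var (inr (a i)))) (@finite_finset _ [set: 'I_n])).
exists q => S b; rewrite /usat qP; split=> [h|->].
  by apply: funext => i; apply: (h _ (ex_intro2 _ _ i I erefl)).
by move=> _ [i _ <-].
Qed.

(** * From tightness to a countable sum of atoms *)

Section Trivial.
Variables (R : realType) (L : language) (U : Type) (S : structure L U) (n : nat).
Variable mu : keisler_measure R S n.

Lemma tight_tuples :
  (forall i e, 0 < e -> exists A p,
     [/\ finite_set A, forall a, usat S a p <-> A (a i) & 1 - e <= mu p]) ->
  forall e, 0 < e -> exists C q,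
     [/\ finite_set C, forall a, usat S a q -> C a & 1 - e <= mu q].
Proof.
(* Each of the [n] coordinates costs at most [d], in total at most [e]; dividing by [n.+1] also
   covers [n = 0]. *)
move=> tight e e0; pose d := e / n.+1%:R.
have d0 : 0 < d by rewrite divr_gt0.
have /choice[A /choice[p Ap]] : forall i : 'I_n, exists A p,
    [/\ finite_set A, forall a, usat S a p <-> A (a i) & 1 - d <= mu p].
  by move=> i; exact: tight.
have step k : exists q, (forall a, usat S a q -> forall i : 'I_n, (i < k)%N -> A i (a i)) /\
    1 - k%:R * d <= mu q.
  elim: k => [|k [q [qA qd]]].
    by exists Top; rewrite kmeasureT mul0r subr0; split=> // a _ i; rewrite ltn0.
  have kd : k.+1%:R * d = k%:R * d + d by rewrite -natr1 mulrDl mul1r.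
  have [kn|nk] := ltnP k n; last first.
    exists q; split=> [a aq i _|]; last by lra.
    by apply: qA => //; apply: leq_trans nk.
  exists (And q (p (Ordinal kn))); split=> [a /usat_And[aq ap] i|].
    rewrite ltnS leq_eqVlt => /orP[/eqP ik|]; last exact: qA.
    have -> : i = Ordinal kn by apply: val_inj.
    by have [_ <- _] := Ap (Ordinal kn).
  have [_ _ pd] := Ap (Ordinal kn); have := kmeasure_And mu q (p (Ordinal kn)); lra.
have [q [qA qd]] := step n.
exists [set a | forall i, (\bigcup_j A j) (a i)], q; split.
- apply: finite_functions; apply: bigcup_finite => // j _.
  by have [] := Ap j.
- by move=> a aq i; exists i => //; apply: qA.
- apply: le_trans qd; rewrite lerD2l lerN2 /d mulrCA ger_pMr //.
  by rewrite ler_pdivrMr // mul1r ler_nat.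
Qed.

(** The finite sets for tolerances tending to 0 have a countable union that carries all the mass.
    Points are definable, so the weights are the measures of the points. *)
Lemma tight_trivial :
  (forall e, 0 < e -> exists C q,
     [/\ finite_set C, forall a, usat S a q -> C a & 1 - e <= mu q]) ->
  trivial_measure mu.
Proof.
move=> tight.
(* Starting at tolerance 1/2 makes the measure of the first formula positive, so that [Y] is
   nonempty and can be enumerated. *)
have /choice[C CP] : forall k : nat, exists C, exists q,
    [/\ finite_set C, forall a, usat S a q -> C a & 1 - k.+2%:R^-1 <= mu q].
  by move=> k; apply: tight; rewrite invr_gt0.
pose Y := \bigcup_k C k.
have Yct : countable Y.
  by apply: bigcup_countable => // k _; have [q [? _ _]] := CP k; apply: finite_set_countable.
have [a Ya] : exists a : nat -> 'I_n -> U, Y `<=` range a.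
  case/pfcard_geP: Yct => [Y0|/unsquash f]; last first.
    by exists f => y /(@surj _ _ _ _ f)[k _ <-]; exists k.
  have [q [_ qC q1]] := CP 0%N; exfalso.
  have : mu q = 0.
    apply: kmeasure_Bot => b /qC Cb; have : Y b by exists 0%N.
    by rewrite Y0.
  by lra.
have /choice[E EP] : forall k, exists p : formula L ('I_n + U),
    forall (S : structure L U) b, usat S b p <-> b = a k.
  by move=> k; exact: point_formula.
pose D := fix D N : formula L ('I_n + U) := if N is k.+1 then Or (D k) (E k) else Bot.
have DP N b : usat S b (D N) <-> exists2 k, (k < N)%N & b = a k.
  elim: N => [|N IH]; first by split=> // -[].
  rewrite usat_Or IH EP; split=> [[[k kN ->]|->]|[k + ->]].
  - by exists k => //; apply: ltnW.
  - by exists N.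
  - by rewrite ltnS leq_eqVlt => /orP[/eqP ->|kN]; [right|left; exists k].
(* The enumeration may repeat points; only the first occurrence receives weight. *)
pose old k := exists2 l, (l < k)%N & a k = a l.
pose r k : R := if pselect (old k) then 0 else mu (E k).
have sumE p N : \sum_(0 <= k < N) r k * dirac_at R S (a k) p = mu (And p (D N)).
  elim: N => [|N IH].
    by rewrite big_geq // kmeasure_Bot // => b /usat_And[].
  rewrite big_nat_recr //= IH /r; case: pselect => [oldN|newN].
    rewrite mul0r addr0; apply: kmeasure_equiv => b.
    rewrite !usat_And (DP N.+1) DP; split=> -[bp [k kN bk]]; split=> //.
      by exists k => //; apply: ltnW.
    move: kN; rewrite ltnS leq_eqVlt => /orP[/eqP kN|kN]; last by exists k.
    by have [l lN aN] := oldN; exists l => //; rewrite bk kN.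
  have -> : mu (And p (Or (D N) (E N))) = mu (And p (D N)) + mu (And p (E N)).
    apply: kmeasure_disjoint => b; rewrite !usat_And ?usat_Or; last by tauto.
    rewrite DP EP => -[[_ [k kN bk]] [_ bN]]; apply: newN; exists k => //.
    by rewrite -bN.
  congr (_ + _); rewrite /dirac_at; have [ap|ap] := pselect (usat S (a N) p).
    rewrite asboolT // mulr1; apply: kmeasure_equiv => b.
    by rewrite usat_And EP; split=> [->//|[]].
  rewrite asboolF // mulr0 kmeasure_Bot // => b.
  by rewrite usat_And EP => -[bp bN]; apply: ap; rewrite -bN.
have cv p : \sum_(0 <= k < N) r k * dirac_at R S (a k) p @[N --> \oo] --> mu p.
  apply/cvgrPdist_le => e e0.
  pose k := Num.truncn e^-1.
  have ke : k.+2%:R^-1 <= e.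
    rewrite invf_ple ?posrE //; apply/ltW; apply: lt_trans (truncnS_gt _) _.
    by rewrite ltr_nat.
  have [q [Cfin qC q1]] := CP k.
  have [c [f fC]] := finite_range Cfin.
  have /choice[g gP] : forall j : 'I_c, exists l, a l = f j.
    move=> j; have [|l _ <-] := Ya (f j); last by exists l.
    by exists k => //; rewrite fC; exists j.
  (* From this index on, [D N] holds at every point of [C k], so the mass missed by the partial sum
     is at most that of [Neg q]. *)
  exists (\max_j (g j).+1)%N => // N /= maxN.
  rewrite sumE (kmeasure_split mu p (D N)) addrAC subrr add0r.
  rewrite ger0_norm ?kmeasure_ge0 //.
  apply: (@le_trans _ _ (mu (Neg q))); last first.
    rewrite kmeasure_Neg lerBlDl -lerBlDr; apply: le_trans q1.
    by rewrite lerD2l lerN2.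
  apply: kmeasure_le => b /usat_And[_ bD] /qC; rewrite fC => -[j _ fj].
  apply: bD; apply/DP; exists (g j); last by rewrite gP.
  by apply: leq_trans maxN; exact: (leq_bigmax j).
exists r, a; split=> // [k|].
  by rewrite /r; case: pselect => ? //; exact: kmeasure_ge0.
(* The total weight is the case of [Top]. *)
have -> : (fun N => \sum_(0 <= k < N) r k) =
    (fun N => \sum_(0 <= k < N) r k * dirac_at R S (a k) Top).
  apply: funext => N; apply: eq_bigr => k _.
  by rewrite /dirac_at asboolT ?mulr1.
by rewrite -(kmeasureT mu); exact: cv.
Qed.

End Trivial.

Theorem theorem4p8 (K : Type) (R : realType)
    (L : language) (T : theory L) (L0 : language) (T0 : theory L0) :
  complete_theory T -> is_reduct K T T0 ->
  dfs_trivial K R T0 -> dfs_trivial K R T.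
Proof.
move=> Tc red triv0 U S monS n n1 mu dfsmu; apply: tight_trivial.
apply: tight_tuples => i e; exact: coordinate_tight Tc red triv0 monS dfsmu.
Qed.
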